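(* Let $V_g>0$ be any given positive control parameter and run the $\mathsf{QRRNUM}$ algorithm (defined in the context) with this parameter. For each slot $t$ let $\boldsymbol{y}(t)=(y_n(t))_{n=1}^N$, $y_n(t)=\min[Q_n(t),\mu_n(t)]$, be the vector of packets served for each user in slot $t$, and let $B\triangleq N\,\mathbb{E}[T_{\max}^2]$. Then the $\mathsf{QRRNUM}$ algorithm stabilizes the network, i.e. for every $n\in\{1,\dots,N\}$, $$\limsup_{t\to\infty}\frac1t\sum_{\tau=0}^{t-1}\mathbb{E}[Q_n(\tau)]<\infty,$$ and it yields average network utility satisfying $$\liminf_{t\to\infty} g\Big(\frac1t\sum_{\tau=0}^{t-1}\mathbb{E}[\boldsymbol{y}(\tau)]\Big)\;\ge\; g(\overline{\boldsymbol{y}}^{*})-\frac{B}{V_g},$$ where $g(\overline{\boldsymbol{y}}^{*})=\max\{g(\overline{\boldsymbol{y}}):\overline{\boldsymbol{y}}\in\Lambda_{\text{int}}\}$ is the optimal value of the constrained utility maximization problem over $\Lambda_{\text{int}}$. Consequently, by taking $V_g$ sufficiently large, the $\mathsf{QRRNUM}$ algorithm achieves network utility arbitrarily close to the optimal $g(\overline{\boldsymbol{y}}^{*})$.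
   Context: **Channels.** Time is slotted, $t=0,1,2,\dots$. There are $N$ users, user $n$ being served over channel $n$. The $N$ channels are independent; channel $n$ has state $s_n(t)\in\{\mathsf{OFF},\mathsf{ON}\}=\{0,1\}$, constant within each slot, evolving as a Markov chain with known transition probabilities $\mathsf{P}_{n,ij}$ from state $i$ to state $j$, with $\mathsf{P}_{n,01}>0$, $\mathsf{P}_{n,10}>0$ and $x_n\triangleq \mathsf{P}_{n,01}+\mathsf{P}_{n,10}<1$ (positive correlation over time). $\mathsf{P}^{(k)}_{n,ij}$ is the $k$-step transition probability and $\pi_{n,\mathsf{ON}}$ the stationary probability of $\mathsf{ON}$. Channel states are not observed before transmission; in each slot at most one user is selected to transmit. A transmission over channel $n$ succeeds iff $s_n(t)=\mathsf{ON}$, and error-free ACK/NACK feedback at the end of the slot reveals the state of the used channel only. The information state is $\boldsymbol{\omega}(t)=(\omega_n(t))_{n=1}^N$, $\omega_n(t)=\Pr[s_n(t)=\mathsf{ON}\mid\text{channel observation history}]$; a channel never observed so far has $\omega_n(t)=\pi_{n,\mathsf{ON}}$. If channel $n$ is the one used in slot $t$, then $\omega_n(t+1)=\mathsf{P}_{n,01}$ if $s_n(t)=\mathsf{OFF}$ and $\omega_n(t+1)=\mathsf{P}_{n,11}$ if $s_n(t)=\mathsf{ON}$; if channel $n$ is not used in slot $t$, then $\omega_n(t+1)=\omega_n(t)\mathsf{P}_{n,11}+(1-\omega_n(t))\mathsf{P}_{n,01}$. **Queues.** User $n$ has an unlimited data source and in slot $t$ admits a real amount $r_n(t)\in[0,1]$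 into an infinite-capacity queue with backlog $Q_n(t)$, $Q_n(0)=0$. The service rate $\mu_n(t)\in\{0,1\}$ equals $1$ iff in slot $t$ user $n$ is selected for (non-dummy) packet transmission and channel $n$ is $\mathsf{ON}$. The backlog evolves as $Q_n(t+1)=\max[Q_n(t)-\mu_n(t),0]+r_n(t)$. Write $\boldsymbol{Q}(t)=(Q_n(t))_n$, $\boldsymbol{r}(t)=(r_n(t))_n$. **Utility.** $g$ is a concave, continuous, nonnegative, (entrywise) nondecreasing real-valued function of the throughput/admission vector (in particular defined on $[0,1]^N$). **Round robin policies.** Let $\Phi=\{0,1\}^N\setminus\{\boldsymbol{0}\}$. For $\boldsymbol{\phi}\in\Phi$, channel $n$ is active if $\phi_n=1$, and $M(\boldsymbol{\phi})$ is the number of active channels. One round of the policy $\mathsf{RR}(\boldsymbol{\phi})$ visits each active channel once in a given order. When switching to active channel $n$ in slot $t$: with probability $\mathsf{P}_{n,01}^{(M(\boldsymbol{\phi}))}/\omega_n(t)$ it keeps transmitting packets over channel $n$ until a NACK is received and then switches to the next active channel; with the complementary probability it transmits one dummy packet (no information content, service rate $0$) over channel $n$ for one slot and then switches to the next active channel. $\boldsymbol{\omega}(t)$ is updated in every slot. $\mathsf{RR}(\boldsymbol{0})$ denotes idling for one slot. The order used is always ''least recently used first''; it is known that this guarantees $\mathsf{P}_{n,01}^{(M(\boldsymbol{\phi}))}\le\omega_n(t)$ whenever the policy switches to an active channel $n$, so the policy is well defined. Let $L_n^{\boldsymbol{\phi}}$ be the time spent on active channel $n$ in one round of $\mathsf{RR}(\boldsymbol{\phi})$;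 its distribution is $\Pr[L_n^{\boldsymbol\phi}=1]=1-\mathsf{P}_{n,01}^{(M(\boldsymbol\phi))}$, $\Pr[L_n^{\boldsymbol\phi}=j]=\mathsf{P}_{n,01}^{(M(\boldsymbol\phi))}(\mathsf{P}_{n,11})^{j-2}\mathsf{P}_{n,10}$ for $j\ge2$, so $\mathbb{E}[L_n^{\boldsymbol\phi}]=1+\mathsf{P}_{n,01}^{(M(\boldsymbol\phi))}/\mathsf{P}_{n,10}$. $T_{\max}$ denotes the length of one round of $\mathsf{RR}(\boldsymbol{1})$, the policy serving all $N$ channels (a sum of the independent variables $L_n^{\boldsymbol 1}$, $n=1,\dots,N$). **Region $\Lambda_{\text{int}}$.** For $\boldsymbol\phi\in\Phi$ let $\boldsymbol\eta^{(\boldsymbol\phi)}=(\eta_n^{(\boldsymbol\phi)})_{n=1}^N$ with $$\eta_n^{(\boldsymbol\phi)}=\frac{\mathsf{P}_{n,01}(1-(1-x_n)^{M(\boldsymbol\phi)})/(x_n\mathsf{P}_{n,10})}{M(\boldsymbol\phi)+\sum_{m:\phi_m=1}\mathsf{P}_{m,01}(1-(1-x_m)^{M(\boldsymbol\phi)})/(x_m\mathsf{P}_{m,10})}\ \text{ if }\phi_n=1,\qquad \eta_n^{(\boldsymbol\phi)}=0\ \text{ if }\phi_n=0.$$ Then $\Lambda_{\text{int}}=\{\boldsymbol\lambda:\boldsymbol0\le\boldsymbol\lambda\le\boldsymbol\mu\text{ entrywise for some }\boldsymbol\mu\in\operatorname{conv}(\{\boldsymbol\eta^{(\boldsymbol\phi)}\}_{\boldsymbol\phi\in\Phi})\}$.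 **The $\mathsf{QRRNUM}$ algorithm** (parameter $V_g>0$). It operates in successive transmission rounds, the first beginning at $t=0$. 1. At the beginning slot $t$ of a round, observe $\boldsymbol Q(t)$ and let $\boldsymbol r^{\mathsf{QRR}}(t)$ be an optimal solution of: maximize $V_g\,g(\boldsymbol r)-\sum_{n=1}^N Q_n(t)r_n$ subject to $r_n\in[0,1]$ for all $n$. 2. Let $\boldsymbol\phi^{\mathsf{QRR}}(t)$ maximize over $\boldsymbol\phi\in\Phi$ $$\frac{\sum_{n=1}^N Q_n(t)\,\mathbb{E}[L_n^{\boldsymbol\phi}-1]\,\phi_n}{\sum_{n=1}^N\mathbb{E}[L_n^{\boldsymbol\phi}]\,\phi_n}.$$ If the maximum is larger than zero, execute $\mathsf{RR}(\boldsymbol\phi^{\mathsf{QRR}}(t))$ for one round with the least-recently-used-first ordering; otherwise idle for one slot. In every slot of this round admit $r_n^{\mathsf{QRR}}(t)$ packets to user $n$, for each $n$. At the end of the round, go to step 1. *)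

(* Defs.v *)
From mathcomp Require Export all_boot all_order all_algebra.
From mathcomp Require Export all_classical all_reals all_analysis.

Set Implicit Arguments.
Unset Strict Implicit.
Unset Printing Implicit Defensive.

Export Order.TTheory GRing.Theory Num.Theory.
Export numFieldNormedType.Exports.

#[export] Set Implicit Arguments.
#[export] Unset Strict Implicit.
#[export] Unset Printing Implicit Defensive.

#[global] Open Scope classical_set_scope.
#[global] Open Scope ring_scope.

(* Users and channels are indexed by 'I_N; channel states are booleans, with
   ON = true and OFF = false; p n i j is the probability that channel n moves
   from state i to state j.  A vector phi in {0,1}^N is encoded by the set
   A : {set 'I_N} of its active channels, so that M(phi) = #|A| and phi <> 0
   reads A != finset.set0. *)

Section Channels.
Context {R : realType} {N : nat}.
Implicit Types (p : 'I_N -> bool -> bool -> R) (pi : 'I_N -> bool -> R).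
Implicit Types (A : {set 'I_N}) (n m : 'I_N).

Definition channel_matrices p : Prop := forall n,
  [/\ forall i j, 0 <= p n i j,
      forall i, \sum_(j : bool) p n i j = 1,
      0 < p n false true, 0 < p n true false &
      p n false true + p n true false < 1].

Definition stationary p pi : Prop := forall n,
  [/\ forall j, 0 <= pi n j,
      \sum_(j : bool) pi n j = 1 &
      forall j, \sum_(i : bool) pi n i * p n i j = pi n j].

Fixpoint kstep p n (k : nat) (i j : bool) : R :=
  if k is k'.+1 then \sum_(l : bool) kstep p n k' i l * p n l j
  else (i == j)%:R.

(* Law of the time spent on an active channel n during one round in which
   M channels are active. *)
Definition L_pmf p n (M j : nat) : R :=
  match j with
  | 0 => 0
  | 1 => 1 - kstep p n M false true
  | j'.+2 => kstep p n M false true * p n true true ^+ j' * p n true false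
  end.

(* E[f(L)] when L has law L_pmf p n M *)
Definition L_mean p n (M : nat) (f : nat -> R) : R :=
  fine (\esum_(j in [set: nat]) (f j * L_pmf p n M j)%:E)%E.

(* E[T_max^2] where T_max is the sum over all n of independent variables with
   laws L_pmf p n N: the joint law is the product of the marginals. *)
Definition Tmax_sq_mean p : \bar R :=
  (\esum_(l in [set: {ffun 'I_N -> nat}])
     (((\sum_n l n)%N%:R ^+ 2 * \prod_n L_pmf p n N (l n))%:E))%E.

Definition drift_bound p : \bar R := (N%:R%:E * Tmax_sq_mean p)%E.

Definition gain p n (M : nat) : R :=
  let x := p n false true + p n true false in
  p n false true * (1 - (1 - x) ^+ M) / (x * p n true false).

Definition eta p A : 'rV[R]_N :=
  \row_n if n \in A
         then gain p n #|A| / (#|A|%:R + \sum_(m in A) gain p m #|A|)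
         else 0.

Definition conv_eta p : set 'rV[R]_N :=
  [set mu | exists w : {set 'I_N} -> R,
     [/\ forall A, 0 <= w A,
         \sum_(A : {set 'I_N} | A != finset.set0) w A = 1 &
         mu = \sum_(A : {set 'I_N} | A != finset.set0) w A *: eta p A]].

Definition Lambda_int p : set 'rV[R]_N :=
  [set lam | exists2 mu, conv_eta p mu &
     forall n, 0 <= lam 0 n /\ lam 0 n <= mu 0 n].

End Channels.

Section Utility.
Context {R : realType} {N : nat}.

Definition cube : set 'rV[R]_N := [set r | forall n, 0 <= r 0 n <= 1].

(* The standing assumptions on the utility are only imposed on [0,1]^N, so
   that utilities defined on a larger domain are covered as well. *)
Definition utility (g : 'rV[R]_N -> R) : Prop :=
  [/\ convex_function cube (fun r => - g r),
      {within cube, continuous g},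
      forall r, cube r -> 0 <= g r &
      forall r r', cube r -> cube r' ->
        (forall n, r 0 n <= r' 0 n) -> g r <= g r'].

End Utility.

Section Algorithm.
Context (R : realType) (N : nat).
Implicit Types (A : {set 'I_N}) (n m : 'I_N).

(* Configuration of the network and of the controller in a slot.
   [last_use n] is 0 if channel n was never used, and t.+1 if it was last used
   in slot t.  [todo] lists the active channels that the current round has not
   switched to yet, in order; [current] is [Some n] when the round is going on
   transmitting packets over channel n, no NACK having been received. *)
Record config := Config {
  backlog : 'rV[R]_N;
  belief : 'rV[R]_N;
  last_use : 'I_N -> nat;
  admitted : 'rV[R]_N;
  nactive : nat;
  todo : seq 'I_N;
  current : option 'I_N }.

Inductive action := Idle | Packet of 'I_N | Dummy of 'I_N.

Definition used (a : action) : option 'I_N :=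
  match a with Idle => None | Packet n | Dummy n => Some n end.

Record decision := Decision {
  dec_admit : 'rV[R]_N;
  dec_active : {set 'I_N};
  dec_order : seq 'I_N }.

(* What is chosen at the beginning of a round.  Ties (among optimal admission
   vectors, among optimal active sets, among never used channels) may be broken
   arbitrarily, on the basis of everything seen so far: the configurations and
   actions of the previous slots, most recent first, and the current
   configuration.  The actual channel states are not part of this record. *)
Definition rule := seq (config * action) -> config -> decision.

Variables (p : 'I_N -> bool -> bool -> R) (pi : 'I_N -> bool -> R).
Variables (g : 'rV[R]_N -> R) (Vg : R).

Definition admission_value (Q r : 'rV[R]_N) : R :=
  Vg * g r - \sum_n Q 0 n * r 0 n.

Definition round_value (Q : 'rV[R]_N) A : R :=
  (\sum_(n in A) Q 0 n * L_mean p n #|A| (fun j => j%:R - 1)) /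
  (\sum_(n in A) L_mean p n #|A| (fun j => j%:R)).

Definition least_recently_used_first (c : config) A (o : seq 'I_N) : Prop :=
  perm_eq o (enum A) /\
  sorted (fun m n => (last_use c m <= last_use c n)%N) o.

Definition is_QRRNUM (rho : rule) : Prop := forall h c,
  let Q := backlog c in
  let: Decision r A o := rho h c in
  [/\ cube r /\ (forall r', cube r' ->
        admission_value Q r' <= admission_value Q r),
      A != finset.set0 /\ (forall A', A' != finset.set0 ->
        round_value Q A' <= round_value Q A) &
      least_recently_used_first c A o].

Definition init_config : config := {|
  backlog := 0;
  belief := \row_n pi n true;
  last_use := fun=> 0%N;
  admitted := 0;
  nactive := 0%N;
  todo := [::];
  current := None |}.

(* If no round is in progress, start one; a round with empty [todo] and no
   [current] channel is the one-slot idle round. *)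
Definition begin_slot (rho : rule) h (c : config) : config :=
  match current c, todo c with
  | None, [::] =>
      let: Decision r A o := rho h c in
      let run := 0 < round_value (backlog c) A in
      {| backlog := backlog c; belief := belief c; last_use := last_use c;
         admitted := r;
         nactive := if run then #|A| else 0%N;
         todo := if run then o else [::];
         current := None |}
  | _, _ => c
  end.

(* The randomization between packets and a dummy packet on switching to
   channel n is driven by the value u of a uniform variable on [0,1]. *)
Definition slot_action (c : config) (u : R) : action :=
  match current c, todo c with
  | Some n, _ => Packet n
  | None, n :: _ =>
      if u < kstep p n (nactive c) false true / belief c 0 n
      then Packet n else Dummy n
  | None, [::] => Idle
  end.

Definition service (a : action) (s : 'I_N -> bool) : 'rV[R]_N :=
  \row_n (if a is Packet m then (m == n) && s n else false)%:R.

Definition end_slot (t : nat) (c : config) (a : action) (s : 'I_N -> bool)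
    : config := {|
  backlog := \row_n (Num.max (backlog c 0 n - service a s 0 n) 0
                     + admitted c 0 n);
  belief := \row_n (if used a == Some n then
                      if s n then p n true true else p n false true
                    else belief c 0 n * p n true true
                         + (1 - belief c 0 n) * p n false true);
  last_use := fun n => if used a == Some n then t.+1 else last_use c n;
  admitted := admitted c;
  nactive := nactive c;
  todo := if current c is Some _ then todo c else behead (todo c);
  current := if a is Packet n then (if s n then Some n else None) else None |}.

(* History before slot t and configuration at the beginning of slot t, along
   the channel path s and the sequence u of values of the uniform variables. *)
Fixpoint run (rho : rule) (s : nat -> 'I_N -> bool) (u : nat -> R) (t : nat)
    : seq (config * action) * config :=
  if t is t'.+1 then
    let: (h, c) := run rho s u t' in
    let c' := begin_slot rho h c in
    let a := slot_action c' (u t') in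
    ((c', a) :: h, end_slot t' c' a (s t'))
  else ([::], init_config).

Definition slot_config rho s u t : config :=
  let: (h, c) := run rho s u t in begin_slot rho h c.

Definition queue rho s u t : 'rV[R]_N := backlog (slot_config rho s u t).

Definition service_rate rho s u t : 'rV[R]_N :=
  service (slot_action (slot_config rho s u t) (u t)) (s t).

Definition served rho s u t : 'rV[R]_N :=
  \row_n Num.min (queue rho s u t 0 n) (service_rate rho s u t 0 n).

End Algorithm.

Section Randomness.
Context {R : realType} {N : nat} {d : measure_display}.
Context {Omega : measurableType d} (Pr : probability Omega R).

Definition agrees (X : nat -> Omega -> bool) (a : nat -> bool) (t : nat)
  : set Omega := [set w | forall tau, (tau <= t)%N -> X tau w = a tau].

Definition markov_chain (q : bool -> bool -> R) (init : bool -> R)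
    (X : nat -> Omega -> bool) : Prop :=
  (forall b, Pr (X 0%N @^-1` [set b]) = (init b)%:E) /\
  (forall a t, Pr (agrees X a t.+1) =
     Pr (agrees X a t) * (q (a t) (a t.+1))%:E)%E.

Definition uniform01 (X : {RV Pr >-> R}) : Prop :=
  forall B, measurable B -> distribution Pr X B = uniform_prob (@ltr01 R) B.

(* Mutual independence of the N channel processes and of the variables U t *)
Definition independent_sources (s : 'I_N -> nat -> {RV Pr >-> bool})
    (U : nat -> {RV Pr >-> R}) : Prop :=
  forall (t : nat) (a : 'I_N -> nat -> bool) (B : nat -> set R),
    (forall tau, measurable (B tau)) ->
    Pr ([set w | (forall n, agrees (s n) (a n) t w) /\
                 (forall tau, (tau <= t)%N -> B tau (U tau w))]) =
    ((\prod_(n < N) Pr (agrees (s n) (a n) t)) *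
     (\prod_(tau < t.+1) Pr (U tau @^-1` B tau)))%E.

(* Channels start from their stationary law, as never observed channels are
   ON with the stationary probability in every slot. *)
Definition channel_processes (p : 'I_N -> bool -> bool -> R)
    (pi : 'I_N -> bool -> R) (s : 'I_N -> nat -> {RV Pr >-> bool})
    (U : nat -> {RV Pr >-> R}) : Prop :=
  [/\ forall n, markov_chain (p n) (pi n) (s n),
      forall t, uniform01 (U t) &
      independent_sources s U].

Section Performance.
Variables (p : 'I_N -> bool -> bool -> R) (pi : 'I_N -> bool -> R).
Variables (s : 'I_N -> nat -> {RV Pr >-> bool}) (U : nat -> {RV Pr >-> R}).
Variable rho : rule R N.

Definition backlog_at (t : nat) (n : 'I_N) (w : Omega) : R :=
  queue p pi rho (fun tau m => s m tau w) (fun tau => U tau w) t 0 n.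

Definition served_at (t : nat) (n : 'I_N) (w : Omega) : R :=
  served p pi rho (fun tau m => s m tau w) (fun tau => U tau w) t 0 n.

Definition time_average (f : nat -> \bar R) (t : nat) : \bar R :=
  ((t%:R^-1)%:E * \sum_(tau < t) f tau)%E.

Definition stabilizes : Prop := forall n : 'I_N,
  (limn_esup (time_average (fun tau => 'E_Pr[backlog_at tau n])) < +oo)%E.

Definition throughput (t : nat) : 'rV[R]_N :=
  \row_n fine (time_average (fun tau => 'E_Pr[served_at tau n]%E) t).

Definition achieved_utility (g : 'rV[R]_N -> R) : \bar R :=
  limn_einf (fun t => (g (throughput t))%:E).

End Performance.
End Randomness.

(* Main.v *)
Require Import Defs.
From mathcomp Require Import ring lra zify measurable_realfun.

(* Conditionally on the feedback, the channels are independent and ON with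
   probabilities given by the beliefs, so expectations of functions of the
   observed state are iterates of a belief kernel K.  Under the least recently
   used ordering a visited channel has belief at least P01^(M), hence a visit
   starts with a successful packet with probability exactly P01^(M).

   Frame-based Lyapunov drift is turned into a one-slot drift.  To the half sum
   of the squared backlogs one adds the expected remaining length of the round
   times its optimal ratio, minus the expected remaining service weighted by
   the backlogs at the start of the round.  In a slot of age i this potential
   grows by at most sum Q r - (optimal ratio) + N (1 + i), the last term since
   backlogs have moved by at most i; the optimal ratio dominates sum Q y for
   every y in Lambda_int, and r maximizes V g(r) - sum Q r.  The sum of 1 + i
   over a round is at most T^2, so a second potential shows that 1 + i is at
   most E[Tmax^2] on average.  Summing over slots bounds the time averages of
   g(r) and of the backlogs; Jensen's inequality and the sublinear growth of
   the backlogs pass from g(r) to the utility of the throughput. *)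

(** The tie-breaking rule is an arbitrary function of the history, so the known state lives in a
    type without a sigma-algebra. Up to slot [t], however, it depends only on finitely many channel
    states and on finitely many comparisons of a uniform variable with a threshold. Every
    expectation is thus a finite sum over cylinders, and every later statement about means concerns
    iterates of a finite mixing operator, free of measurability and integrability conditions.

    The drift is taken slot by slot because the averages run up to a deterministic [t], which may
    fall inside a round of random length. Telescoping over slots then needs no count of completed
    rounds and no stopped sums: an unfinished round only enters through the potentials at time [t],
    whose correction terms are either bounded in mean or absorbed by the squared backlogs. *)

Section Mix.
Context {R : realFieldType}.
Implicit Types q x y : R.

Definition mix q x y : R := q * x + (1 - q) * y.

(** For a uniform [U] on [0,1] this is the probability of [U < q], whatever the real [q]. The kernel
    is therefore a probability kernel in every state, even where the threshold is not known to lie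
    in [0,1]. *)
Definition clip q : R := Num.max 0 (Num.min q 1).

Lemma clip_itv q : 0 <= clip q <= 1.
Proof. by rewrite /clip le_max lexx/= ge_max ler01 ge_min lexx orbT. Qed.

Lemma clip_id q : 0 <= q <= 1 -> clip q = q.
Proof. by move=> /andP[q0 q1]; rewrite /clip min_l// max_r. Qed.

Lemma mix_same q x : mix q x x = x.
Proof. by rewrite /mix; ring. Qed.

Lemma ler_mix q x x' y y' : 0 <= q <= 1 -> x <= x' -> y <= y' ->
  mix q x y <= mix q x' y'.
Proof.
move=> /andP[q0 q1] xx yy; apply: lerD; apply: ler_wpM2l => //.
by rewrite subr_ge0.
Qed.

End Mix.

(** * Controlled chains driven by hidden Markov channels *)

(* [Y] is what the controller knows; [chan y] is the channel whose state is
   revealed in the current slot, and [v] is the outcome of the controller's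
   coin, true with probability [thr y] clipped to [0, 1]. *)
Section HiddenChain.
Context {R : realType} {N : nat} (p : 'I_N -> bool -> bool -> R).
Context {Y : Type} (thr : Y -> R) (bel : Y -> 'I_N -> R).
Context (chan : Y -> option 'I_N) (step : Y -> ('I_N -> bool) -> bool -> Y).
Implicit Types (F : Y -> R) (G : Y -> {ffun 'I_N -> bool} -> R).
Implicit Types (st : {ffun 'I_N -> bool}).

Definition bern (b : R) (x : bool) : R := if x then b else 1 - b.

Definition trans st (st' : {ffun 'I_N -> bool}) : R := \prod_n p n (st n) (st' n).

Definition filtered G (y : Y) : R :=
  \sum_(st : {ffun 'I_N -> bool}) (\prod_n bern (bel y n) (st n)) * G y st.

Definition hidden_op G (y : Y) st : R :=
  \sum_(st' : {ffun 'I_N -> bool}) trans st st' *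
    mix (clip (thr y)) (G (step y st true) st') (G (step y st false) st').

(** The constant states [fun=> true] and [fun=> false] stand for all hidden states: [step] will only
    look at the revealed channel. *)
Definition belief_op F (y : Y) : R :=
  let F' v := if chan y is Some n
    then mix (bel y n) (F (step y (fun=> true) v)) (F (step y (fun=> false) v))
    else F (step y (fun=> true) v) in
  mix (clip (thr y)) (F' true) (F' false).

Hypothesis p_stochastic : forall n i, \sum_(j : bool) p n i j = 1.
Hypothesis step_dep : forall y (st st' : 'I_N -> bool) v,
  (forall n, chan y = Some n -> st n = st' n) -> step y st v = step y st' v.
Hypothesis bel_step : forall y (st : 'I_N -> bool) v n,
  bel (step y st v) n =
    if chan y == Some n then p n (st n) true
    else bel y n * p n true true + (1 - bel y n) * p n false true.

Let p_false n i : p n i false = 1 - p n i true.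
Proof. by have := p_stochastic n i; rewrite big_bool/= => <-; ring. Qed.

(* Given the observations the channels are independent with ON probabilities
   [bel], and one slot of the joint chain preserves this product form. *)
Lemma filtered_hidden_op G y :
  filtered (hidden_op G) y = belief_op (filtered G) y.
Proof.
pose H v : R := \sum_(st : {ffun 'I_N -> bool}) (\prod_n bern (bel y n) (st n)) *
  \sum_(st' : {ffun 'I_N -> bool}) trans st st' * G (step y st v) st'.
have -> : filtered (hidden_op G) y = mix (clip (thr y)) (H true) (H false).
  rewrite /filtered /hidden_op /mix /H 2!(mulr_sumr (index_enum _)) -big_split/=.
  apply: eq_bigr => st _; rewrite [clip _ * _]mulrCA [(1 - clip _) * _]mulrCA.
  rewrite -mulrDr; congr (_ * _).
  by rewrite !mulr_sumr -big_split/=; apply: eq_bigr => st' _; ring.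
have HE v : H v = if chan y is Some n then
    mix (bel y n) (filtered G (step y (fun=> true) v))
      (filtered G (step y (fun=> false) v))
  else filtered G (step y (fun=> true) v).
  (* On a set [P] of hidden states all leading to [y1], it is enough that the weight of [P], moved
     by one slot, be [w] times the product law given by the beliefs of [y1]; [w] is the probability
     of the observation. *)
  have push (P : pred {ffun 'I_N -> bool}) (w : R) (y1 : Y) :
      (forall st, P st -> step y st v = y1) ->
      (forall st', \sum_(st | P st) (\prod_n bern (bel y n) (st n)) * trans st st'
          = w * \prod_n bern (bel y1 n) (st' n)) ->
      \sum_(st | P st) (\prod_n bern (bel y n) (st n)) *
         \sum_(st' : {ffun 'I_N -> bool}) trans st st' * G (step y st v) st' = w * filtered G y1.
    move=> Py1 Pw; rewrite /filtered mulr_sumr.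
    under eq_bigr do rewrite mulr_sumr.
    rewrite exchange_big/=; apply: eq_bigr => st' _; rewrite mulrA -Pw mulr_suml.
    by apply: eq_bigr => st Pst; rewrite Py1// mulrA.
  case yn : (chan y) => [n|]; last first.
    rewrite /H -[RHS]mul1r; apply: (push xpredT).
      by move=> st _; apply: step_dep; rewrite yn.
    move=> st'; rewrite mul1r.
    transitivity (\sum_(st : {ffun 'I_N -> bool})
                    \prod_n (bern (bel y n) (st n) * p n (st n) (st' n))).
      by apply: eq_bigr => st _; rewrite /trans -big_split.
    rewrite -(bigA_distr_bigA (fun n b => bern (bel y n) b * p n b (st' n)))/=.
    apply: eq_bigr => n _; rewrite bel_step yn/= big_bool/=.
    by case: (st' n); rewrite /= ?p_false; ring.
  have side b : \sum_(st : {ffun 'I_N -> bool} | st n == b)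
      (\prod_n bern (bel y n) (st n)) *
      \sum_(st' : {ffun 'I_N -> bool}) trans st st' * G (step y st v) st' =
      bern (bel y n) b * filtered G (step y (fun=> b) v).
    apply: push.
      by move=> st /eqP <-; apply: step_dep => m; rewrite yn => -[->].
    move=> st'; rewrite big_mkcond/=.
    (* The observation [st n = b] becomes a factor on coordinate [n], so that the restricted sum
       still distributes over the channels. *)
    pose u m c := (if m == n then (c == b)%:R else 1) *
                  (bern (bel y m) c * p m c (st' m)).
    transitivity (\sum_(st : {ffun 'I_N -> bool}) \prod_m u m (st m)).
      apply: eq_bigr => st _; rewrite /u big_split/= [X in _ = X * _](bigD1 n)//= eqxx.
      rewrite [X in _ * X * _]big1 ?mulr1; last by move=> m /negbTE ->.
      rewrite /trans -big_split/=.
      by case: (st n == b); rewrite ?mul1r ?mul0r.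
    rewrite -(bigA_distr_bigA u)/= (bigD1 n)//= [in RHS](bigD1 n)//= mulrA.
    congr (_ * _); first by rewrite /u eqxx bel_step yn eqxx big_bool/=;
      case: (b); case: (st' n); rewrite /= ?p_false; ring.
    apply: eq_bigr => m mn; rewrite bel_step yn /u (negbTE mn) big_bool/=.
    have /negbTE -> : Some n != Some m by apply: contra mn => /eqP[->].
    by case: (st' m); rewrite /= ?p_false; ring.
  by rewrite /H (bigID (fun st : {ffun 'I_N -> bool} => st n == true))/= side; congr (_ + _);
    rewrite -(side false); apply: eq_bigl => st; case: (st n).
by rewrite /belief_op/= -!HE.
Qed.

(** For a function of the known state alone the hidden states integrate out, which leaves a chain
    driven by beliefs only. *)
Lemma filtered_iter_hidden_op k F y :
  filtered (iter k hidden_op (fun y _ => F y)) y = iter k belief_op F y.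
Proof.
elim: k y => [|k IH] y /=.
  rewrite /filtered -mulr_suml.
  rewrite -(bigA_distr_bigA (fun n b => bern (bel y n) b))/= big1 ?mul1r//.
  by move=> n _; rewrite big_bool/=; ring.
by rewrite filtered_hidden_op; congr (belief_op _ y); apply/funext => z.
Qed.

End HiddenChain.

(** * Expectations along channel paths *)

Section FinitePartition.
Context {d} {T : measurableType d} {R : realType}.
Context (mu : {measure set T -> \bar R}).

(** Measurability on the union is part of the conclusion: the integrands of interest depend on an
    arbitrary rule and are only understood piece by piece. *)
Lemma ge0_integral_finite_partition (I : finType) (F : I -> set T)
    (f : T -> \bar R) :
  (forall i, measurable (F i)) -> trivIset setT F ->
  (forall i, measurable_fun (F i) f) ->
  (forall x, (\bigcup_i F i) x -> (0 <= f x)%E) ->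
  measurable_fun (\bigcup_i F i) f /\
  (\int[mu]_(x in \bigcup_i F i) f x = \sum_i \int[mu]_(x in F i) f x)%E.
Proof.
move=> mF tF mf f0.
have UE : \bigcup_i F i = \big[setU/set0]_(i <- index_enum I) F i.
  rewrite -bigcup_seq; apply/seteqP; split => x [i _ Fx]; exists i => //=.
  exact: mem_index_enum.
have mU : measurable_fun (\big[setU/set0]_(i <- index_enum I) F i) f.
  elim: (index_enum I) => [|i r IH]; first by rewrite big_nil; exact: measurable_fun_set0.
  rewrite big_cons; apply/measurable_funU => //.
  by apply: bigsetU_measurable.
rewrite UE in f0 *; split => //.
rewrite ge0_integral_bigsetU ?index_enum_uniq//.
exact: sub_trivIset tF.
Qed.

End FinitePartition.

Section Uniform.
Context {d} {Omega : measurableType d} {R : realType}.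
Context (Pr : probability Omega R).

Lemma uniform01_lt (X : {RV Pr >-> R}) (c : R) : uniform01 X ->
  Pr (X @^-1` [set u | u < c]) = (clip c)%:E.
Proof.
move=> uX.
have -> : [set u | u < c] = `]-oo, c[%classic.
  by apply/seteqP; split => u /=; rewrite in_itv.
have := uX `]-oo, c[%classic (measurable_itv _).
rewrite /distribution/= /pushforward => ->.
rewrite /uniform_prob integral_uniform_pdf.
have oneE (x : R) : `[0, 1]%classic x -> (uniform_pdf 0 1 x)%:E = 1%E :> \bar R.
  by rewrite /= in_itv /uniform_pdf/= => ->; rewrite subr0 invr1.
have [c0|c0] := leP c 0.
  rewrite (_ : _ `&` _ = set0) ?integral_set0; last first.
    apply/seteqP; split => x //=; rewrite !in_itv/= => -[xc /andP[x0 _]].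
    by have := lt_le_trans (le_lt_trans x0 xc) c0; rewrite ltxx.
  by rewrite /clip max_l// ge_min c0.
have [c1|c1] := ltP 1 c.
  rewrite (_ : _ `&` _ = `[0, 1]%classic); last first.
    apply/seteqP; split => x //=; rewrite !in_itv/=; first by case.
    by move=> /[dup] /andP[_ x1] ->; split => //; exact: le_lt_trans c1.
  rewrite (eq_integral (cst 1%E)); last by move=> x; rewrite inE => /oneE.
  rewrite integral_cst//= lebesgue_measure_itv/= lte_fin ltr01 mul1e.
  by rewrite /clip min_r ?max_r// ?ltW// oppr0 adde0.
rewrite (_ : _ `&` _ = `[0, c[%classic); last first.
  apply/seteqP; split => x //=; rewrite !in_itv/=.
    by case=> xc /andP[x0 _]; rewrite x0.
  by move=> /andP[x0 xc]; rewrite x0 xc; split => //; rewrite (ltW (lt_le_trans xc c1)).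
rewrite (eq_integral (cst 1%E)); last first.
  move=> x; rewrite inE/= in_itv/= => /andP[x0 xc]; apply: oneE.
  by rewrite /= in_itv/= x0 (ltW (lt_le_trans xc c1)).
rewrite integral_cst//= lebesgue_measure_itv/= lte_fin c0 mul1e.
by rewrite /clip min_l// max_r ?ltW// oppr0 adde0.
Qed.

End Uniform.

Section PathIntegral.
Context {R : realType} {N : nat} (p : 'I_N -> bool -> bool -> R)
  (pi : 'I_N -> bool -> R).
Context {d} {Omega : measurableType d} {Pr : probability Omega R}.
Context (s : 'I_N -> nat -> {RV Pr >-> bool}) (U : nat -> {RV Pr >-> R}).
Context {Y : Type} (thr : Y -> R) (step : Y -> ('I_N -> bool) -> bool -> Y).
Context (y0 : Y).
Hypothesis sU : channel_processes p pi s U.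

Fixpoint chain (st : nat -> 'I_N -> bool) (u : nat -> R) (t : nat) : Y :=
  if t is t'.+1
  then step (chain st u t') (st t') (u t' < thr (chain st u t'))
  else y0.

Definition chain_at t w : Y :=
  chain (fun tau n => s n tau w) (fun tau => U tau w) t.

Definition states_at t w : {ffun 'I_N -> bool} := [ffun n => s n t w].

(** In use, the cuts are trivial from index [t] on: hidden states are fixed up to slot [t] included,
    coins only before slot [t]. This determines the known state in slot [t] and the hidden state it
    faces. *)
Definition cylinder (a : 'I_N -> nat -> bool) (B : nat -> set R) t : set Omega :=
  [set w | (forall n, agrees (s n) (a n) t w) /\
           (forall tau, (tau <= t)%N -> B tau (U tau w))].

Lemma measurable_cylinder a B t : (forall tau, measurable (B tau)) ->
  measurable (cylinder a B t).
Proof.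
move=> mB.
have -> : cylinder a B t = \bigcap_(tau in [set tau | (tau <= t)%N])
    (\bigcap_(n in [set: 'I_N]) (s n tau @^-1` [set a n tau]) `&` U tau @^-1` B tau).
  apply/seteqP; split => w.
    by move=> [aw Bw] tau taut; split; [move=> n _; exact: aw|exact: Bw].
  move=> H; split => [n tau /H[H1 _]|tau /H[]//].
  exact: H1.
apply: bigcap_measurable; first by exists 0%N.
move=> tau _; apply: measurableI.
  apply: fin_bigcap_measurable => // n _.
  by rewrite -[X in measurable X]setTI; exact: (measurable_funPT (s n tau)).
by rewrite -[X in measurable X]setTI; exact: (measurable_funPT (U tau)).
Qed.

Definition extend_path (a : 'I_N -> nat -> bool) t (st : 'I_N -> bool) n tau :=
  if tau == t then st n else a n tau.

Definition extend_cuts (B : nat -> set R) t (C : set R) tau :=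
  if tau == t then C else B tau.

(** Independence factors both cylinders; the channels then contribute one Markov transition each,
    and the coins the single new factor of slot [t]. *)
Lemma cylinder_extend_prob a B t st C :
  (forall tau, measurable (B tau)) -> measurable C ->
  (forall tau, (t <= tau)%N -> B tau = setT) ->
  Pr (cylinder (extend_path a t.+1 st) (extend_cuts B t C) t.+1) =
  (Pr (cylinder a B t) * (\prod_n p n (a n t) (st n))%:E *
   Pr (U t @^-1` C))%E.
Proof.
move=> mB mC BT; case: sU => sM _ ind.
have mB' tau : measurable (extend_cuts B t C tau).
  by rewrite /extend_cuts; case: ifP.
rewrite /cylinder ind// ind//.
rewrite big_ord_recr/= [X in (_ * (X * _))%E]big_ord_recr/=.
rewrite [X in (_ = (_ * X) * _ * _)%E]big_ord_recr/= BT//.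
have -> : Pr (U t.+1 @^-1` extend_cuts B t C t.+1) = 1%E.
  by rewrite /extend_cuts gtn_eqF// BT// preimage_setT probability_setT.
rewrite preimage_setT probability_setT !mule1.
have -> : extend_cuts B t C t = C by rewrite /extend_cuts eqxx.
have -> : (\prod_(i < t) Pr (U i @^-1` extend_cuts B t C i) =
           \prod_(i < t) Pr (U i @^-1` B i))%E.
  by apply: eq_bigr => i _; rewrite /extend_cuts ltn_eqF.
have -> : (\prod_(n < N) Pr (agrees (s n) (extend_path a t.+1 st n) t.+1) =
    (\prod_(n < N) Pr (agrees (s n) (a n) t)) *
    (\prod_n p n (a n t) (st n))%:E)%E.
  rewrite -prodEFin -big_split/=; apply: eq_bigr => n _.
  have [_ ->] := sM n; rewrite /extend_path eqxx ltn_eqF//; congr (Pr _ * _)%E.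
  by apply/seteqP; split => w + tau taut => /(_ _ taut); rewrite ltn_eqF.
by rewrite [LHS]muleAC !muleA [RHS]muleAC.
Qed.

(* By induction on m for all cylinders at once: a cylinder on which the known
   state is constant splits, one slot later, into finitely many of them. *)
Lemma integral_cylinder (G : Y -> {ffun 'I_N -> bool} -> R) m t a B y :
  (forall y st, 0 <= G y st) ->
  (forall tau, measurable (B tau)) ->
  (forall tau, (t <= tau)%N -> B tau = setT) ->
  (forall w, cylinder a B t w -> chain_at t w = y) ->
  let f w := (G (chain_at (t + m) w) (states_at (t + m) w))%:E in
  measurable_fun (cylinder a B t) f /\
  (\int[Pr]_(w in cylinder a B t) f w =
   Pr (cylinder a B t) *
     (iter m (hidden_op p thr step) G y [ffun n => a n t])%:E)%E.
Proof.
move=> G0; elim: m t a B y => [|m IH] t a B y mB BT Ey f.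
  have fE : {in cylinder a B t, f =1 cst (G y [ffun n => a n t])%:E}.
    move=> w; rewrite inE => aw; rewrite /f addn0 /= (Ey _ aw); congr (G _ _)%:E.
    by apply/ffunP => n; rewrite !ffunE; apply: aw.1.
  have mE := measurable_cylinder a t mB.
  split; first by apply: eq_measurable_fun (measurable_cst _) => w /fE ->.
  by rewrite (eq_integral _ _ fE) integral_cst// muleC.
pose C (v : bool) : set R := [set u | (u < thr y) = v].
have mC v : measurable (C v).
  case: v.
    have -> : C true = `]-oo, thr y[%classic.
      by apply/seteqP; split => u /=; rewrite in_itv.
    exact: measurable_itv.
  have -> : C false = `[thr y, +oo[%classic.
    by apply/seteqP; split => u; rewrite /C/= in_itv/= andbT leNgt; case: (u < thr y).
  exact: measurable_itv.
have PC v : Pr (U t @^-1` C v) =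
    (if v then clip (thr y) else 1 - clip (thr y))%:E.
  have [_ /(_ t)/(uniform01_lt (thr y)) PU _] := sU.
  have CE : C true = [set u | u < thr y] by apply/seteqP; split.
  case: v; first by rewrite CE.
  have -> : C false = ~` C true.
    by apply/seteqP; split => u; rewrite /C/=; case: (u < thr y).
  have mt : measurable (U t @^-1` C true).
    by rewrite -[X in measurable X]setTI; exact: (measurable_funPT (U t)).
  by rewrite -preimage_setC probability_setC// CE PU EFinB.
(* The pieces are indexed by the hidden states in slot [t.+1] and the outcome of the coin of slot
   [t]. *)
pose I := ({ffun 'I_N -> bool} * bool)%type.
pose F (i : I) := cylinder (extend_path a t.+1 i.1) (extend_cuts B t (C i.2)) t.+1.
have EF : cylinder a B t = \bigcup_i F i.
  apply/seteqP; split => w.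
    move=> [aw Bw]; exists (states_at t.+1 w, U t w < thr y) => //; split => /=.
      move=> n tau; rewrite /extend_path leq_eqVlt.
      by case: eqP => [->|_]; rewrite ?ffunE//= => /aw.
    move=> tau; rewrite /extend_cuts leq_eqVlt => /orP[/eqP ->|].
      by rewrite gtn_eqF// BT.
    by case: eqP => [->//|_]; exact: Bw.
  move=> [[st v] _ [/= aw Bw]]; split.
    move=> n tau taut; have := aw n tau (leqW taut).
    by rewrite /extend_path ltn_eqF.
  move=> tau taut; have := Bw tau (leqW taut); rewrite /extend_cuts.
  by case: eqP => // ->; rewrite BT.
have tF : trivIset setT F.
  move=> [st v] [st' v'] _ _ [w [[/= aw Bw] [/= aw' Bw']]]; congr pair.
    apply/ffunP => n; have := aw n _ (leqnn _); have := aw' n _ (leqnn _).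
    by rewrite /extend_path eqxx => -> ->.
  have := Bw t (leqnSn _); have := Bw' t (leqnSn _).
  by rewrite /extend_cuts eqxx /C/= => -> ->.
have mB' v tau : measurable (extend_cuts B t (C v) tau).
  by rewrite /extend_cuts; case: ifP.
have mF i : measurable (F i) by exact: measurable_cylinder.
have Fy i w : F i w -> chain_at t.+1 w = step y [ffun n => a n t] i.2.
  move=> Fw; have Ew : cylinder a B t w by rewrite EF; exists i.
  rewrite /chain_at/= -/(chain_at t w) (Ey _ Ew).
  have -> : (U t w < thr y) = i.2.
    by have := Fw.2 t (leqnSn _); rewrite /extend_cuts eqxx.
  by congr (step _ _ _); apply/funext => n; rewrite ffunE; apply: Ew.1.
have BT' v tau : (t < tau)%N -> extend_cuts B t (C v) tau = setT.
  by move=> ttau; rewrite /extend_cuts gtn_eqF// BT// ltnW.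
have IHi i := IH t.+1 _ _ _ (mB' i.2) (BT' i.2) (Fy i).
have fE : f = fun w => (G (chain_at (t.+1 + m) w) (states_at (t.+1 + m) w))%:E.
  by rewrite /f addnS.
have f0 w : (0 <= f w)%E by rewrite lee_fin.
have mfi i : measurable_fun (F i) f by rewrite fE; exact: (IHi i).1.
have [mf If] := ge0_integral_finite_partition Pr mF tF mfi (fun w _ => f0 w).
rewrite EF; split => //; rewrite If -EF.
have FI i : (\int[Pr]_(w in F i) f w = Pr (cylinder a B t) *
    (trans p [ffun n => a n t] i.1 *
     ((if i.2 then clip (thr y) else 1 - clip (thr y)) *
     iter m (hidden_op p thr step) G (step y [ffun n => a n t] i.2) i.1))%:E)%E.
  rewrite fE (IHi i).2 /F cylinder_extend_prob// PC -!muleA -!EFinM.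
  congr (_ * (_ * (_ * _))%:E)%E.
    by apply: eq_bigr => n _; rewrite ffunE.
  congr (iter _ _ _ _ _).
  by apply/ffunP => n; rewrite ffunE /extend_path eqxx.
under eq_bigr do rewrite FI.
rewrite -(fineK (fin_num_measure Pr _ (measurable_cylinder a t mB))).
under eq_bigr do rewrite -EFinM.
rewrite sumEFin -mulr_sumr EFinM.
congr (_ * _%:E)%E; rewrite /hidden_op/=.
rewrite -(pair_bigA _ (fun st v => trans p [ffun n => a n t] st *
     ((if v then clip (thr y) else 1 - clip (thr y)) *
     iter m (hidden_op p thr step) G (step y [ffun n => a n t] v) st)))/=.
by apply: eq_bigr => st _; rewrite big_bool/= -mulrDr.
Qed.

Context (bel : Y -> 'I_N -> R) (chan : Y -> option 'I_N).
Hypothesis p_stochastic : forall n i, \sum_(j : bool) p n i j = 1.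
Hypothesis pi_stochastic : forall n, \sum_(j : bool) pi n j = 1.
Hypothesis step_dep : forall y (st st' : 'I_N -> bool) v,
  (forall n, chan y = Some n -> st n = st' n) -> step y st v = step y st' v.
Hypothesis bel_step : forall y (st : 'I_N -> bool) v n,
  bel (step y st v) n =
    if chan y == Some n then p n (st n) true
    else bel y n * p n true true + (1 - bel y n) * p n false true.
Hypothesis bel_y0 : forall n, bel y0 n = pi n true.

(** The space is partitioned by the hidden states in slot 0. Since the channels start from [pi], the
    weights of the pieces are the product of the beliefs of [y0], so the sum is [filtered] at
    [y0]. *)
Lemma expectation_chain (F : Y -> R) t : (forall y, 0 <= F y) ->
  (\int[Pr]_w (F (chain_at t w))%:E =
   (iter t (belief_op thr bel chan step) F y0)%:E)%E.
Proof.
move=> F0; rewrite -(filtered_iter_hidden_op _ p_stochastic step_dep bel_step).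
pose E (st : {ffun 'I_N -> bool}) := cylinder (fun n _ => st n) (fun=> setT) 0.
have mE st : measurable (E st) by exact: measurable_cylinder.
have ET : [set: Omega] = \bigcup_st E st.
  apply/seteqP; split => // w _; exists (states_at 0 w) => //; split => // n tau.
  by rewrite leqn0 => /eqP ->; rewrite ffunE.
have tE : trivIset setT E.
  move=> st st' _ _ [w [[/= aw _] [aw' _]]]; apply/ffunP => n.
  by rewrite -(aw n _ (leqnn _)) -(aw' n _ (leqnn _)).
have IE st := integral_cylinder (y := y0) (G := fun y _ => F y) t
  (fun y _ => F0 y) (fun=> measurableT) (fun _ _ => erefl) (t := 0) (a := fun n _ => st n)
  (fun _ _ => erefl).
have mf st : measurable_fun (E st) (fun w => (F (chain_at t w))%:E).
  exact: (IE st).1.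
have [_] := ge0_integral_finite_partition Pr mE tE mf (fun w _ => F0 _).
rewrite -ET => ->.
rewrite /filtered -sumEFin; apply: eq_bigr => st _.
rewrite (IE st).2 EFinM; congr (_ * _)%E.
  case: sU => sM _ ind; rewrite (ind 0 (fun n _ => st n) (fun=> setT))// big_ord1 preimage_setT.
  rewrite probability_setT mule1 -prodEFin; apply: eq_bigr => n _.
  have [H _] := sM n.
  rewrite (_ : agrees _ _ _ = s n 0%N @^-1` [set st n]); last first.
    apply/seteqP; split => w /=; first by apply.
    by move=> H1 tau; rewrite leqn0 => /eqP ->.
  rewrite H bel_y0 /bern; case: (st n) => //; congr (_%:E).
  by have := pi_stochastic n; rewrite big_bool/= => <-; ring.
by congr (iter _ _ _ _ _)%:E; apply/ffunP => n; rewrite ffunE.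
Qed.

End PathIntegral.

Lemma cube_mix {R : realType} {N : nat} (q : R) (x y : 'rV[R]_N) : 0 <= q <= 1 ->
  cube x -> cube y -> cube (\row_n mix q (x 0 n) (y 0 n)).
Proof.
move=> q01 cx cy n; rewrite mxE.
have /andP[x0 x1] := cx n; have /andP[y0 y1] := cy n.
rewrite -[X in X <= _ <= _](mix_same q) -[X in _ <= _ <= X](mix_same q).
by rewrite !ler_mix.
Qed.

Lemma utility_mix {R : realType} {N : nat} (g : 'rV[R]_N -> R) (q : R)
    (x y : 'rV[R]_N) : utility g -> 0 <= q <= 1 -> cube x -> cube y ->
  mix q (g x) (g y) <= g (\row_n mix q (x 0 n) (y 0 n)).
Proof.
move=> [gconc _ _ _] /andP[q0 q1] cx cy.
have := gconc (Itv01 q0 q1) x y; rewrite !inE => /(_ cx cy).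
rewrite convRE /= lerNl opprD !mulrN !opprK /mix => /le_trans; apply.
rewrite le_eqVlt; apply/orP; left; apply/eqP; congr (g _).
by apply/matrixP => i j; rewrite !ord1 !mxE.
Qed.

(** * Means under the belief kernel *)

Section BeliefOperator.
Context {R : realType} {N : nat} {Y : Type}.
Context (thr : Y -> R) (bel : Y -> 'I_N -> R).
Context (chan : Y -> option 'I_N) (step : Y -> ('I_N -> bool) -> bool -> Y).
Context (I : Y -> Prop).
Hypothesis I_step : forall y st v, I y -> I (step y st v).
Hypothesis I_bel : forall y n, I y -> 0 <= bel y n <= 1.
Implicit Types (F G : Y -> R).

Local Notation K := (belief_op thr bel chan step).

Definition kernel_mean (t : nat) F (y : Y) : R := iter t K F y.

Local Notation E := kernel_mean.

Lemma belief_op_cst F y c : (forall st v, F (step y st v) = c) -> K F y = c.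
Proof.
by move=> Fc; rewrite /belief_op !Fc; case: chan => [n|]; rewrite !mix_same.
Qed.

Lemma belief_opD F G y : K (fun z => F z + G z) y = K F y + K G y.
Proof. by rewrite /belief_op; case: chan => [n|]; rewrite /mix; ring. Qed.

Lemma belief_opZ c F y : K (fun z => c * F z) y = c * K F y.
Proof. by rewrite /belief_op; case: chan => [n|]; rewrite /mix; ring. Qed.

Lemma belief_op_le F G y : I y ->
  (forall st v, F (step y st v) <= G (step y st v)) -> K F y <= K G y.
Proof.
move=> Iy FG; rewrite /belief_op; case: chan => [n|].
  by do 3?[apply: ler_mix => //]; rewrite ?clip_itv ?I_bel.
by apply: ler_mix => //; rewrite clip_itv.
Qed.

Lemma kernel_mean_cst t c y : E t (fun=> c) y = c.
Proof.
elim: t y => [//|t IH] y; rewrite /kernel_mean/=.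
by apply: belief_op_cst => st v; exact: IH.
Qed.

Lemma kernel_meanS t F y : E t.+1 F y = E t (K F) y.
Proof. by rewrite /kernel_mean iterSr. Qed.

Lemma kernel_meanD t F G y : E t (fun z => F z + G z) y = E t F y + E t G y.
Proof.
elim: t F G => [//|t IH] F G; rewrite !kernel_meanS -IH.
by congr (iter _ _ _ _); apply/funext => z; exact: belief_opD.
Qed.

Lemma kernel_meanZ t c F y : E t (fun z => c * F z) y = c * E t F y.
Proof.
elim: t F => [//|t IH] F; rewrite !kernel_meanS -IH.
by congr (iter _ _ _ _); apply/funext => z; exact: belief_opZ.
Qed.

Lemma kernel_mean_le t F G y : I y -> (forall z, I z -> F z <= G z) ->
  E t F y <= E t G y.
Proof.
move=> + FG; elim: t y => [|t IH] y Iy; first exact: FG.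
by rewrite /kernel_mean/=; apply: belief_op_le => // st v; apply/IH/I_step.
Qed.

Lemma eq_kernel_mean t F G y : I y -> (forall z, I z -> F z = G z) ->
  E t F y = E t G y.
Proof.
by move=> Iy FG; apply/eqP; rewrite eq_le !kernel_mean_le// => z Iz; rewrite FG.
Qed.

Lemma kernel_mean_drift t F G y : I y -> (forall z, I z -> K F z <= F z + G z) ->
  E t.+1 F y <= E t F y + E t G y.
Proof. by move=> Iy FG; rewrite kernel_meanS -kernel_meanD; exact: kernel_mean_le. Qed.

(** Jensen's inequality by induction on [t]: one slot is a nested pair of two-point mixtures, to
    which [utility_mix] applies. Membership in [cube] is carried along because concavity is only
    available there. *)
Lemma kernel_mean_concave (g : 'rV[R]_N -> R) t (X : Y -> 'rV[R]_N) y :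
  utility g -> I y -> (forall z, I z -> cube (X z)) ->
  let Xbar := \row_n E t (fun z => X z 0 n) y in
  cube Xbar /\ E t (fun z => g (X z)) y <= g Xbar.
Proof.
move=> ug + cX; elim: t y => [|t IH] y Iy /=.
  have -> : \row_n E 0 (fun z => X z 0 n) y = X y.
    by apply/matrixP => i j; rewrite ord1 mxE.
  by split => //; exact: cX.
pose Z z := \row_n E t (fun z => X z 0 n) z.
have IHs st v := IH (step y st v) (I_step st v Iy).
have [n0|cy] := boolP (chan y == None); last first.
  case Ec : (chan y) cy => [m|//] _.
  pose W v := \row_n mix (bel y m) (Z (step y (fun=> true) v) 0 n)
                (Z (step y (fun=> false) v) 0 n).
  have cW v : cube (W v) by apply: cube_mix (I_bel m Iy) (IHs _ _).1 (IHs _ _).1.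
  have -> : \row_n E t.+1 (fun z => X z 0 n) y =
      \row_n mix (clip (thr y)) (W true 0 n) (W false 0 n).
    by apply/matrixP => i j; rewrite !mxE /kernel_mean/= /belief_op Ec.
  split; first exact: cube_mix (clip_itv _) _ _.
  apply: le_trans (utility_mix ug (clip_itv _) (cW true) (cW false)).
  rewrite /kernel_mean/= /belief_op Ec; apply: ler_mix (clip_itv _) _ _.
    apply: le_trans (utility_mix ug (I_bel m Iy) (IHs _ _).1 (IHs _ _).1).
    by apply: ler_mix (I_bel m Iy) _ _; exact: (IHs _ _).2.
  apply: le_trans (utility_mix ug (I_bel m Iy) (IHs _ _).1 (IHs _ _).1).
  by apply: ler_mix (I_bel m Iy) _ _; exact: (IHs _ _).2.
move/eqP: n0 => Ec.
have -> : \row_n E t.+1 (fun z => X z 0 n) y =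
    \row_n mix (clip (thr y)) (Z (step y (fun=> true) true) 0 n)
      (Z (step y (fun=> true) false) 0 n).
  by apply/matrixP => i j; rewrite !mxE /kernel_mean/= /belief_op Ec.
split; first exact: cube_mix (clip_itv _) (IHs _ _).1 (IHs _ _).1.
apply: le_trans (utility_mix ug (clip_itv _) (IHs _ _).1 (IHs _ _).1).
rewrite /kernel_mean/= /belief_op Ec.
by apply: ler_mix (clip_itv _) _ _; exact: (IHs _ _).2.
Qed.

End BeliefOperator.

(** Every path stays in the invariant, so a function nonnegative there may be replaced by its
    positive part before [expectation_chain] is applied. *)
Lemma expectation_chain_inv {R : realType} {N : nat}
    (p : 'I_N -> bool -> bool -> R) (pi : 'I_N -> bool -> R)
    {d} {Omega : measurableType d} {Pr : probability Omega R}
    (s : 'I_N -> nat -> {RV Pr >-> bool}) (U : nat -> {RV Pr >-> R})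
    {Y : Type} (thr : Y -> R) (bel : Y -> 'I_N -> R) (chan : Y -> option 'I_N)
    (step : Y -> ('I_N -> bool) -> bool -> Y) (y0 : Y) (I : Y -> Prop)
    (F : Y -> R) (t : nat) :
  channel_processes p pi s U ->
  (forall n i, \sum_(j : bool) p n i j = 1) ->
  (forall n, \sum_(j : bool) pi n j = 1) ->
  (forall y (st st' : 'I_N -> bool) v,
    (forall n, chan y = Some n -> st n = st' n) -> step y st v = step y st' v) ->
  (forall y (st : 'I_N -> bool) v n,
    bel (step y st v) n =
    if chan y == Some n then p n (st n) true
    else bel y n * p n true true + (1 - bel y n) * p n false true) ->
  (forall n, bel y0 n = pi n true) ->
  (forall y st v, I y -> I (step y st v)) ->
  (forall y n, I y -> 0 <= bel y n <= 1) ->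
  I y0 -> (forall y, I y -> 0 <= F y) ->
  (\int[Pr]_w (F (chain_at s U thr step y0 t w))%:E =
   (kernel_mean thr bel chan step t F y0)%:E)%E.
Proof.
move=> sU p1 pi1 stepd bels bel0 Is Ib I0 F0.
have Ic w : forall t, I (chain_at s U thr step y0 t w).
  by elim=> [//|t' IH]; rewrite /chain_at/=; exact: Is.
transitivity (\int[Pr]_w
    (Num.max 0 (F (chain_at s U thr step y0 t w)))%:E)%E.
  by apply: eq_integral => w _; rewrite max_r ?F0.
rewrite (expectation_chain thr sU p1 pi1 stepd bels bel0 t (F := fun y => Num.max 0 (F y))).
  congr (_%:E); rewrite -/(kernel_mean thr bel chan step t _ y0).
  apply: (eq_kernel_mean thr chan Is Ib) => // z Iz.
  by rewrite max_r ?F0.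
by move=> y; rewrite le_max lexx.
Qed.

(** * Channels and the network as a Markov chain *)

Section ChannelFacts.
Context {R : realType} {N : nat} (p : 'I_N -> bool -> bool -> R).
Hypothesis hp : channel_matrices p.
Implicit Types n : 'I_N.

Lemma channel_rowsum n i : p n i true + p n i false = 1.
Proof. by have [_ /(_ i) + _ _ _] := hp n; rewrite big_bool. Qed.

Lemma channel_ge0 n i j : 0 <= p n i j.
Proof. by have [/(_ i j)] := hp n. Qed.

Lemma channel01_gt0 n : 0 < p n false true.
Proof. by have [] := hp n. Qed.

Lemma channel10_gt0 n : 0 < p n true false.
Proof. by have [] := hp n. Qed.

Lemma channel01_lt11 n : p n false true < p n true true.
Proof. by have [_ _ _ _] := hp n; have := channel_rowsum n true; lra. Qed.

Lemma channel11_le1 n : p n true true <= 1.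
Proof. by have := channel_rowsum n true; have := channel_ge0 n true false; lra. Qed.

(** The evolution of a belief is affine with slope [p11 - p01], which is positive because the
    channel is positively correlated over time. *)
Lemma ler_evolve n (b b' : R) : b <= b' ->
  b * p n true true + (1 - b) * p n false true <=
  b' * p n true true + (1 - b') * p n false true.
Proof.
move=> bb; have E (c : R) : c * p n true true + (1 - c) * p n false true =
  p n false true + c * (p n true true - p n false true) by ring.
by rewrite [leLHS]E [leRHS]E lerD2l ler_wpM2r// subr_ge0 ltW// channel01_lt11.
Qed.

Lemma kstep_rowsum n k i : kstep p n k i true + kstep p n k i false = 1.
Proof.
elim: k => [|k IH]; first by case: i => /=; rewrite ?addr0 ?add0r.
rewrite /= !big_bool/= addrACA -!mulrDr !channel_rowsum !mulr1; exact: IH.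
Qed.

Lemma kstepS n k i : kstep p n k.+1 i true =
  kstep p n k i true * p n true true + (1 - kstep p n k i true) * p n false true.
Proof. by rewrite -(kstep_rowsum n k i) addrAC subrr add0r /= big_bool. Qed.

Lemma kstep01E n k : let x := p n false true + p n true false in
  kstep p n k false true = p n false true * (1 - (1 - x) ^+ k) / x.
Proof.
move=> x; have x0 : x != 0.
  by rewrite gt_eqF// addr_gt0 ?channel01_gt0 ?channel10_gt0.
have p11 : p n true true = 1 - x + p n false true.
  by rewrite /x; have := channel_rowsum n true; lra.
elim: k => [|k IH]; first by rewrite expr0 subrr mulr0 mul0r.
rewrite kstepS IH p11 exprS; by field.
Qed.

(** The sequence starts at 0, its smallest possible value, and is iterated by the monotone evolution
    of beliefs. *)
Lemma kstep01_le n k l : (k <= l)%N -> kstep p n k false true <= kstep p n l false true.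
Proof.
move=> kl; rewrite -(subnK kl); elim: (l - k)%N => [//|j IH].
apply: (le_trans IH); rewrite addSn; elim: (j + k)%N => [|i IHi].
  by rewrite kstepS /= mul0r add0r subr0 mul1r ltW// channel01_gt0.
by rewrite [leRHS]kstepS [leLHS]kstepS ler_evolve.
Qed.

Lemma kstep01_ge0 n k : 0 <= kstep p n k false true.
Proof. exact: (@kstep01_le n 0). Qed.

Lemma kstep01_gt0 n k : (0 < k)%N -> 0 < kstep p n k false true.
Proof.
move=> /(kstep01_le n); apply: lt_le_trans.
by rewrite kstepS /= mul0r add0r subr0 mul1r channel01_gt0.
Qed.

Lemma kstep01_le1 n k : kstep p n k false true <= 1.
Proof.
have := kstep_rowsum n k false; suff : 0 <= kstep p n k false false by lra.
elim: k => [//|k IH]; rewrite /= big_bool/=.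
by rewrite addr_ge0// mulr_ge0 ?channel_ge0 ?kstep01_ge0.
Qed.

(** The stationary probability is a fixed point of the monotone evolution that is iterated from
    [P01^(0) = 0]. *)
Lemma kstep01_le_stationary (pi : 'I_N -> bool -> R) n k : stationary p pi ->
  kstep p n k false true <= pi n true.
Proof.
move=> hpi; have [pi0 pi1 /(_ true) piE] := hpi n.
rewrite big_bool/= in pi1; rewrite big_bool/= in piE.
have pif : pi n false = 1 - pi n true by rewrite -pi1; ring.
by elim: k => [|k IH]; [exact: pi0|rewrite kstepS -piE pif ler_evolve].
Qed.

End ChannelFacts.

Section NetworkChain.
Context {R : realType} {N : nat} (p : 'I_N -> bool -> bool -> R).
Context (pi : 'I_N -> bool -> R) (rho : rule R N).
Implicit Types (c : config R N) (h : seq (config R N * action N)).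
Implicit Types (m n : 'I_N).

Definition round_over c : bool :=
  if current c is Some _ then false else nilp (todo c).

Definition channel_in_use c : option 'I_N :=
  if current c is Some n then Some n else ohead (todo c).

Definition packet_threshold c : R :=
  match current c, todo c with
  | None, n :: _ => kstep p n (nactive c) false true / belief c 0 n
  | _, _ => 0
  end.

Definition chosen_action c (v : bool) : action N :=
  match current c, todo c with
  | Some n, _ => Packet n
  | None, n :: _ => if v then Packet n else Dummy n
  | None, [::] => Idle N
  end.

(* The configuration is the one reached once the decisions of a starting round
   have been taken; [age] counts the slots elapsed in the round in progress,
   [round_backlog] is the backlog observed when it started. *)
Record network := Network {
  past : seq (config R N * action N);
  conf : config R N;
  age : nat;
  round_backlog : 'rV[R]_N;
  round_rate : R }.

Implicit Type y : network.

Definition new_round h c : network := {|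
  past := h;
  conf := begin_slot p rho h c;
  age := 0%N;
  round_backlog := backlog c;
  round_rate := Num.max 0 (round_value p (backlog c) (dec_active (rho h c))) |}.

Definition next_conf y (st : 'I_N -> bool) v : config R N :=
  end_slot p (size (past y)) (conf y) (chosen_action (conf y) v) st.

Definition next_past y v := (conf y, chosen_action (conf y) v) :: past y.

Definition advance y (st : 'I_N -> bool) v : network :=
  if round_over (next_conf y st v)
  then new_round (next_past y v) (next_conf y st v)
  else {| past := next_past y v; conf := next_conf y st v; age := (age y).+1;
          round_backlog := round_backlog y; round_rate := round_rate y |}.

Definition start : network := new_round [::] (init_config pi).

Lemma slot_action_chosen c u :
  slot_action p c u = chosen_action c (u < packet_threshold c).
Proof.
by rewrite /slot_action /chosen_action /packet_threshold; case: current => //; case: todo.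
Qed.

Lemma begin_slot_id h c : ~~ round_over c -> begin_slot p rho h c = c.
Proof. by rewrite /round_over /begin_slot; case: current => //; case: todo. Qed.

Lemma begin_slot_same h c : let c' := begin_slot p rho h c in
  [/\ backlog c' = backlog c, belief c' = belief c, last_use c' = last_use c &
      current c' = current c].
Proof.
case: c => Q b l r k [|? ?] [?|] //=.
by rewrite /begin_slot/=; case: (rho h _).
Qed.

Lemma advance_conf y st v :
  conf (advance y st v) = begin_slot p rho (next_past y v) (next_conf y st v).
Proof. by rewrite /advance; case: ifPn => //= /begin_slot_id ->. Qed.

Lemma advance_past y st v : past (advance y st v) = next_past y v.
Proof. by rewrite /advance; case: ifP. Qed.

Lemma advance_dep y (st st' : 'I_N -> bool) v :
  (forall n, channel_in_use (conf y) = Some n -> st n = st' n) ->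
  advance y st v = advance y st' v.
Proof.
move=> ss; suff E : next_conf y st v = next_conf y st' v by rewrite /advance E.
have us n : used (chosen_action (conf y) v) = Some n -> st n = st' n.
  move=> H; apply: ss; move: H; rewrite /channel_in_use /chosen_action.
  by case: current => [//|]; case: todo => [//|k l]/=; case: v.
rewrite /next_conf /end_slot; congr Config.
- apply/matrixP => i j; rewrite !mxE; congr (Num.max (_ - (_)%:R) _ + _).
  move: us; case: (chosen_action _ _) => //= k /(_ k erefl) stk.
  by case: eqP => //= <-; rewrite stk.
- apply/matrixP => i j; rewrite !mxE; case: ifP => // /eqP/us -> //.
- by move: us; case: (chosen_action _ _) => //= k /(_ k erefl) ->.
Qed.

Definition network_belief y n : R := belief (conf y) 0 n.

Lemma advance_belief y st v n :
  network_belief (advance y st v) n =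
    if channel_in_use (conf y) == Some n then p n (st n) true
    else network_belief y n * p n true true +
         (1 - network_belief y n) * p n false true.
Proof.
rewrite /network_belief advance_conf.
have [_ -> _ _] := begin_slot_same (next_past y v) (next_conf y st v).
rewrite /next_conf /end_slot/= mxE.
have -> : used (chosen_action (conf y) v) = channel_in_use (conf y).
  rewrite /chosen_action /channel_in_use.
  by case: current => [//|]; case: todo => [//|k l]/=; case: v.
by case: ifP => //; case: (st n).
Qed.

(** The size of the past is part of the statement because [next_conf] takes its slot number from the
    length of the history instead of storing a clock. *)
Lemma chain_network (st : nat -> 'I_N -> bool) (u : nat -> R) t :
  let y := chain (packet_threshold \o conf) advance start st u t in
  slot_config p pi rho st u t = conf y /\ (run p pi rho st u t).1 = past y /\
  size (past y) = t.
Proof.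
elim: t => [//|t]/=; set y := chain _ _ _ _ _ t.
rewrite /slot_config/=; case: (run p pi rho st u t) => h c /= [Ec [Eh Et]].
rewrite advance_conf advance_past /next_conf /next_past Et -slot_action_chosen.
by rewrite /= Et -Ec -Eh.
Qed.

(** The amount served depends on the state revealed during the slot, so it is a function of the
    known state one slot later: a packet got through over [n] exactly when [n] is then the current
    channel. *)
Definition served_before n y : R :=
  if past y is (c, _) :: _ then
    Num.min (backlog c 0 n) (current (conf y) == Some n)%:R
  else 0.

Lemma service_hit c v (st : 'I_N -> bool) t n :
  service R (chosen_action c v) st 0 n =
  (current (end_slot p t c (chosen_action c v) st) == Some n)%:R :> R.
Proof.
rewrite mxE /=; case: (chosen_action c v) => //= k.
case: eqP => [->|kn]; first by case: (st n); rewrite ?eqxx.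
by case: ifP => // _; case: eqP => // -[].
Qed.

Lemma served_chain (st : nat -> 'I_N -> bool) (u : nat -> R) t n :
  served p pi rho st u t 0 n =
  served_before n (chain (packet_threshold \o conf) advance start st u t.+1).
Proof.
have [Ec _] := chain_network st u t; move: Ec; set y := chain _ _ _ _ _ t => Ec.
rewrite /served /queue /service_rate mxE Ec slot_action_chosen.
rewrite (service_hit _ _ _ (size (past y))) /= /served_before advance_past advance_conf /=.
rewrite -/y; set v := u t < _.
by have [_ _ _ ->] := begin_slot_same (next_past y v) (next_conf y (st t) v).
Qed.

End NetworkChain.

Arguments network R N : clear implicits.

(** * Invariants of the controlled network *)

Section NetworkInvariant.
Context {R : realType} {N : nat} (p : 'I_N -> bool -> bool -> R).
Context (pi : 'I_N -> bool -> R) (g : 'rV[R]_N -> R) (Vg : R) (rho : rule R N).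
Hypotheses (hp : channel_matrices p) (hpi : stationary p pi).
Hypothesis hrho : is_QRRNUM p g Vg rho.
Implicit Types (c : config R N) (h : seq (config R N * action N)).
Implicit Types (m n : 'I_N) (y : network R N).

(* A channel last used in slot l - 1 has since evolved from a known state, so
   its belief dominates the one it would have if that state were OFF. *)
Record observed (t : nat) c : Prop := Observed {
  last_use_le : forall n, (last_use c n <= t)%N;
  last_use_inj : forall m n, (0 < last_use c m)%N ->
    last_use c m = last_use c n -> m = n;
  belief_ge : forall n k,
    (last_use c n == 0)%N || (last_use c n + k <= t.+1)%N ->
    kstep p n k false true <= belief c 0 n;
  belief_le1 : forall n, belief c 0 n <= 1 }.

(** A channel waiting behind [i] others in a round with [M] active channels has belief at least
    [P01^(M-i)]. Each visit takes at least one slot, so the exponent has risen to [M] by the time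
    the channel is reached. *)
Record scheduled c : Prop := Scheduled {
  todo_uniq : uniq (todo c);
  current_notin : forall n, current c = Some n -> n \notin todo c;
  current_belief : forall n, current c = Some n -> belief c 0 n = p n true true;
  todo_belief : forall l1 n l2, todo c = l1 ++ n :: l2 ->
    kstep p n (nactive c - size l1) false true <= belief c 0 n }.

Record controlled y : Prop := Controlled {
  observed_conf : observed (size (past y)) (conf y);
  scheduled_conf : scheduled (conf y);
  backlog_ge0 : forall n, 0 <= backlog (conf y) 0 n;
  backlog_near : forall n,
    `|backlog (conf y) 0 n - round_backlog y 0 n| <= (age y)%:R;
  round_backlog_ge0 : forall n, 0 <= round_backlog y 0 n;
  admitted_cube : cube (admitted (conf y));
  admitted_opt : forall r, cube r ->
    admission_value g Vg (round_backlog y) r <=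
    admission_value g Vg (round_backlog y) (admitted (conf y));
  round_rate_ge0 : 0 <= round_rate y;
  round_rate_max : forall A, A != finset.set0 ->
    round_value p (round_backlog y) A <= round_rate y;
  idle_rate : round_over (conf y) -> round_rate y = 0 }.

Lemma observed_belief_gt0 t c n : observed t c -> 0 < belief c 0 n.
Proof.
move=> oc; apply: (lt_le_trans (kstep01_gt0 hp n (ltn0Sn 0))).
by apply: (belief_ge oc); rewrite addn1 ltnS (last_use_le oc) orbT.
Qed.

Lemma used_chosen c v : used (chosen_action c v) = channel_in_use c.
Proof.
rewrite /chosen_action /channel_in_use.
by case: current => [//|]; case: todo => [//|k l]/=; case: v.
Qed.

Lemma end_slot_belief t c v st n :
  belief (end_slot p t c (chosen_action c v) st) 0 n =
  if channel_in_use c == Some n then p n (st n) true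
  else belief c 0 n * p n true true + (1 - belief c 0 n) * p n false true.
Proof. by rewrite mxE used_chosen; case: ifP => //; case: (st n). Qed.

Lemma observed_end_slot t c v st : observed t c ->
  observed t.+1 (end_slot p t c (chosen_action c v) st).
Proof.
move=> oc; split.
- move=> n /=; case: ifP => // _; exact: leqW (last_use_le oc n).
- move=> m n /=; rewrite used_chosen; case: eqP => [->|_].
    case: eqP => [[]//|_] _ E; have := last_use_le oc n.
    by rewrite -E ltnn.
  case: eqP => [_|_]; last exact: (last_use_inj oc).
  by move=> _ E; have := last_use_le oc m; rewrite E ltnn.
- move=> n k; rewrite end_slot_belief /= used_chosen; case: ifP => _.
    rewrite addSn !ltnS => tk; have k1 : (k <= 1)%N by lia.
    apply: (le_trans (kstep01_le hp n k1)).
    rewrite kstepS// /= mul0r add0r subr0 mul1r.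
    by case: (st n) => //; rewrite ltW// channel01_lt11.
  case: k => [|k] hk.
    rewrite addr_ge0// mulr_ge0// ?channel_ge0// ?subr_ge0 ?(belief_le1 oc)//.
    exact/ltW/observed_belief_gt0/oc.
  rewrite kstepS// ler_evolve//; apply: (belief_ge oc).
  by move: hk; rewrite addnS !ltnS => ->.
- move=> n; rewrite end_slot_belief; case: ifP => _.
    case: (st n); first exact: channel11_le1.
    by apply: le_trans (channel11_le1 hp n); rewrite ltW// channel01_lt11.
  apply: (@le_trans _ _ (1 * p n true true + (1 - 1) * p n false true)).
    by rewrite ler_evolve// (belief_le1 oc).
  by rewrite subrr mul0r addr0 mul1r channel11_le1.
Qed.

Lemma end_slot_todo t c v st :
  todo (end_slot p t c (chosen_action c v) st) =
  if current c is Some _ then todo c else behead (todo c).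
Proof. by []. Qed.

Lemma channel_in_use_notin c n : scheduled c ->
  channel_in_use c = Some n ->
  n \notin (if current c is Some _ then todo c else behead (todo c)).
Proof.
move=> sc; rewrite /channel_in_use.
case Ec: (current c) => [m|].
  by move=> [<-]; exact: (current_notin sc).
have := todo_uniq sc; case: (todo c) => [//|m l] /= /andP[ml _] [<-] //.
Qed.

Lemma scheduled_end_slot t c v st : scheduled c ->
  scheduled (end_slot p t c (chosen_action c v) st).
Proof.
move=> sc; set c' := end_slot _ _ _ _ _.
have cur n : current c' = Some n -> channel_in_use c = Some n /\ st n.
  rewrite -(used_chosen c v) /c' /end_slot /=.
  by case: (chosen_action c v) => //= m; case: ifP => // stm [<-].
split.
- rewrite end_slot_todo; case: (current c) => [_|]; first exact: (todo_uniq sc).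
  by have := todo_uniq sc; case: (todo c) => //= m l /andP[].
- by move=> n /cur[+ _]; rewrite end_slot_todo; exact: channel_in_use_notin.
- by move=> n /cur[E stn]; rewrite end_slot_belief E eqxx stn.
- move=> l1 n l2 E.
  have nin : n \in (if current c is Some _ then todo c else behead (todo c)).
    by rewrite -(end_slot_todo t c v st) E mem_cat inE eqxx orbT.
  rewrite end_slot_belief; case: eqP => [/(channel_in_use_notin sc)|_].
    by rewrite nin.
  (* If a visit starts in this slot, the waiting channel was one position further back; the missing
     step of [kstep] is supplied by the evolution of its belief during the slot. *)
  pose k := (nactive c - (current c == None) - size l1)%N.
  have kb : kstep p n k false true <= belief c 0 n.
    move: E; rewrite end_slot_todo {}/k; case Ec: (current c) => [m|]/=.
      by rewrite subn0; exact: (todo_belief sc).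
    case Et: (todo c) => [|m l]/=; first by case: (l1).
    move=> El; have := todo_belief sc (l1 := m :: l1) (n := n) (l2 := l2).
    by rewrite /= -[(size l1).+1]add1n subnDA; apply; rewrite Et El.
  apply: le_trans (ler_evolve hp n kb).
  rewrite -kstepS//; apply: kstep01_le => //=; rewrite /k; case: eqP => /=; lia.
Qed.

Lemma scheduled_least_recently_used t c A o (r : 'rV[R]_N) : observed t c ->
  least_recently_used_first c A o ->
  scheduled {| backlog := backlog c; belief := belief c; last_use := last_use c;
    admitted := r; nactive := #|A|; todo := o; current := None |}.
Proof.
move=> oc [pe so].
have uo : uniq o by rewrite (perm_uniq pe) enum_uniq.
have sA : #|A| = size o by rewrite (perm_size pe) cardE.
split => //= l1 n l2 E; apply: (belief_ge oc).
case: eqP => //= /eqP; rewrite -lt0n => ln0.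
have -> : (#|A| - size l1 = (size l2).+1)%N.
  by rewrite sA E size_cat /= addnC addnK.
rewrite addnS ltnS.
have nl : forall m, m \in l2 -> (last_use c n < last_use c m <= t)%N.
  move=> m ml; rewrite (last_use_le oc) andbT ltn_neqAle; apply/andP; split.
    apply/eqP => /(last_use_inj oc ln0) nm.
    by move: uo; rewrite E cat_uniq /= nm ml !andbF.
  move: so; rewrite E sorted_cat_cons => /andP[_].
  rewrite path_sortedE; last by move=> ? ? ?; exact: leq_trans.
  by move=> /andP[/allP/(_ _ ml)].
have ul : uniq (map (last_use c) l2).
  rewrite map_inj_in_uniq.
    by move: uo; rewrite E cat_uniq /= => /and4P[].
  move=> a b al bl; apply: (last_use_inj oc).
  by have /andP[/(leq_ltn_trans (leq0n _))] := nl a al.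
have := uniq_leq_size (s2 := iota (last_use c n).+1 (t - last_use c n)) ul.
rewrite size_iota size_map => H.
have {}H : (size l2 <= t - last_use c n)%N.
  apply: H => k /mapP[m ml ->]; rewrite mem_iota.
  by have := nl m ml; have := last_use_le oc n; lia.
by have := last_use_le oc n; lia.
Qed.

Lemma begin_slot_conf h c : round_over c ->
  let Q := backlog c in
  let: Decision r A o := rho h c in
  let run := 0 < round_value p Q A in
  begin_slot p rho h c = {|
    backlog := Q; belief := belief c; last_use := last_use c; admitted := r;
    nactive := if run then #|A| else 0%N; todo := if run then o else [::];
    current := None |}.
Proof.
by case: c => Q b l r k [|? ?] [?|] //= _; rewrite /begin_slot /=; case: (rho h _).
Qed.

Lemma controlled_new_round h c : round_over c -> observed (size h) c ->
  (forall n, 0 <= backlog c 0 n) -> controlled (new_round p rho h c).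
Proof.
move=> ro oc Q0; have := begin_slot_conf h ro; have := hrho h c.
case Er: (rho h c) => [r A o]/= [[cr ropt] [A0 Aopt] lru] Ec.
have oc' : observed (size h) (begin_slot p rho h c) by rewrite Ec; case: oc.
have sc' : scheduled (begin_slot p rho h c).
  rewrite Ec; case: ifP => _; first exact: scheduled_least_recently_used oc lru.
  by split => //= -[].
split => //=; rewrite ?Er/=.
- by rewrite Ec.
- by move=> n; rewrite Ec subrr normr0.
- by rewrite Ec.
- by rewrite Ec.
- by rewrite le_max lexx.
- by move=> A' A'0; rewrite le_max Aopt// orbT.
- rewrite Ec /round_over/=; case: ifP => [_|/negbT]; last by rewrite -leNgt => /max_l.
  have [pe _] := lru; rewrite /nilp (perm_size pe) -cardE => /eqP/cards0_eq A00.
  by rewrite A00 eqxx in A0.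
Qed.

Lemma service_itv (a : action N) st n : 0 <= service R a st 0 n <= 1.
Proof. by rewrite mxE ler0n lern1; case: a => * /=; rewrite ?leq_b1. Qed.

Lemma controlled_advance y st v : controlled y -> controlled (advance p rho y st v).
Proof.
move=> cy.
have oc : observed (size (past y)).+1 (next_conf p y st v).
  exact: observed_end_slot (observed_conf cy).
have sc : scheduled (next_conf p y st v).
  exact: scheduled_end_slot (scheduled_conf cy).
have step n : backlog (conf y) 0 n - 1 <= backlog (next_conf p y st v) 0 n
    <= backlog (conf y) 0 n + 1 /\ 0 <= backlog (next_conf p y st v) 0 n.
  rewrite mxE; have := service_itv (chosen_action (conf y) v) st n.
  have := admitted_cube cy n; have := backlog_ge0 cy n.
  by move: (service _ _ _ _ _) => mu; case: (leP 0 (_ - mu)); lra.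
rewrite /advance; case: ifPn => ro.
  by apply: controlled_new_round => // n; exact: (step n).2.
split => //=; try by case: cy.
- by move=> n; exact: (step n).2.
- move=> n; have := backlog_near cy n; have [+ _] := step n.
  by rewrite !ler_norml -natr1; lra.
- by rewrite (negbTE ro).
Qed.

Lemma controlled_start : controlled (start p pi rho).
Proof.
apply: controlled_new_round => //=; last by move=> n; rewrite mxE.
split => //= n; first by move=> k _; rewrite mxE kstep01_le_stationary.
have [pi0 pi1 _] := hpi n; rewrite mxE -pi1 big_bool/= lerDl; exact: pi0.
Qed.

Lemma controlled_belief y n : controlled y -> 0 <= network_belief y n <= 1.
Proof.
move=> cy; rewrite (belief_le1 (observed_conf cy)) andbT.
exact/ltW/observed_belief_gt0/observed_conf/cy.
Qed.

End NetworkInvariant.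

(** * Moments of the round length *)

Section Moments.
Context {R : realType}.

(** By induction [u] stays below the fixed point of the limiting recurrence; being nondecreasing it
    converges, and its limit solves the fixed-point equation. *)
Lemma affine_recurrence_cvg (x c : R) (u v : nat -> R) : 0 <= x < 1 ->
  u 0%N = 0 -> (forall k, u k.+1 = x * u k + v k) ->
  {homo u : m n / (m <= n)%N >-> m <= n} -> (forall k, v k <= c) ->
  v @ \oo --> c -> u @ \oo --> c / (1 - x).
Proof.
move=> /andP[x0 x1] u0 uS umono vc vcvg.
have x1' : 0 < 1 - x by rewrite subr_gt0.
have ub k : u k <= c / (1 - x).
  elim: k => [|k IH].
    have h : 0 <= v 0%N.
      by have := umono 0%N 1%N isT; rewrite uS u0 mulr0 add0r.
    by rewrite u0 divr_ge0 ?(le_trans h (vc _))// ltW.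
  rewrite uS; have h1 := vc k; have h2 := ler_wpM2l x0 IH.
  have -> : c / (1 - x) = x * (c / (1 - x)) + c by field; rewrite gt_eqF.
  exact: lerD.
have ucvg : cvgn u.
  by apply: nondecreasing_is_cvgn => //; exists (c / (1 - x)) => _ [k _ <-].
have lE : limn u = x * limn u + c.
  have h1 : (fun k => x * u k + v k) @ \oo --> x * limn u + c.
    by apply: cvgD => //; apply: cvgM => //; exact: cvg_cst.
  have h2 : (fun k => u k.+1) @ \oo --> limn u by rewrite cvg_shiftS.
  have uE : (fun k => u k.+1) = (fun k => x * u k + v k) by apply/funext.
  by rewrite uE in h2; exact: (cvg_unique _ h2 h1).
suff -> : c / (1 - x) = limn u by [].
have cE : c = (1 - x) * limn u by rewrite mulrBl mul1r {1}lE; ring.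
by rewrite cE mulrAC divff ?mul1r// gt_eqF.
Qed.

(** Shifting the index turns these partial sums into affine recurrences driven by the lower moments,
    from which the limits follow without generating functions. *)
Definition power_moment (x : R) (e k : nat) : R :=
  \sum_(i < k) i.+1%:R ^+ e * x ^+ i.

Lemma power_moment_homo x e : 0 <= x ->
  {homo power_moment x e : m n / (m <= n)%N >-> m <= n}.
Proof.
move=> x0 m n mn; rewrite /power_moment -!(big_mkord xpredT (fun i => i.+1%:R ^+ e * x ^+ i)).
by rewrite [leRHS](big_cat_nat (leq0n m) mn)/= lerDl sumr_ge0// => i _; rewrite mulr_ge0 ?exprn_ge0.
Qed.

Lemma power_moment0S x k : power_moment x 0 k.+1 = x * power_moment x 0 k + 1.
Proof.
rewrite /power_moment big_ord_recl/= !expr0 mulr1 addrC mulr_sumr; congr (_ + _).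
by apply: eq_bigr => i _; rewrite /bump/= add1n [x ^+ _.+1]exprS; ring.
Qed.

Lemma power_moment1S x k : power_moment x 1 k.+1 =
  x * power_moment x 1 k + (1 + x * power_moment x 0 k).
Proof.
rewrite /power_moment big_ord_recl/= !expr0 !expr1 mulr1 [RHS]addrCA; congr (_ + _).
rewrite -mulrDr -big_split/= mulr_sumr; apply: eq_bigr => i _.
by rewrite /bump/= add1n [x ^+ _.+1]exprS -[i.+2%:R]natr1; ring.
Qed.

Lemma power_moment2S x k : power_moment x 2 k.+1 = x * power_moment x 2 k +
  (1 + 2 * x * power_moment x 1 k + x * power_moment x 0 k).
Proof.
rewrite /power_moment big_ord_recl/= !expr0 expr1n mulr1 -!addrA [RHS]addrCA.
congr (_ + _).
rewrite [2 * x]mulrC -mulrA -!mulrDr mulr_sumr -!big_split/= mulr_sumr.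
apply: eq_bigr => i _.
by rewrite /bump/= add1n [x ^+ _.+1]exprS -[i.+2%:R]natr1; ring.
Qed.

Lemma power_moment_cvg x : 0 <= x < 1 -> let a := (1 - x)^-1 in
  [/\ power_moment x 0 @ \oo --> a, power_moment x 1 @ \oo --> a ^+ 2 &
      power_moment x 2 @ \oo --> (1 + x) * a ^+ 3].
Proof.
move=> x01 a; have /andP[x0 x1] := x01.
have x1' : 1 - x != 0 by rewrite gt_eqF// subr_gt0.
have u0 e : power_moment x e 0 = 0 by rewrite /power_moment big_ord0.
have h0 : power_moment x 0 @ \oo --> a.
  have -> : a = 1 / (1 - x) by rewrite div1r.
  apply: (affine_recurrence_cvg (v := fun=> 1)) => //; last exact: cvg_cst.
    exact: power_moment0S.
  exact: power_moment_homo.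
have le_lim e l : power_moment x e @ \oo --> l -> forall k, power_moment x e k <= l.
  move=> cl k; rewrite -(cvg_lim _ cl)//.
  by apply: nondecreasing_cvgn_le; [exact: power_moment_homo|exact: cvgP cl].
have h1 : power_moment x 1 @ \oo --> a ^+ 2.
  have -> : a ^+ 2 = (1 + x * a) / (1 - x) by rewrite /a; field.
  apply: (affine_recurrence_cvg _ _ (power_moment1S x)) => //.
  - exact: power_moment_homo.
  - by move=> k; rewrite lerD2l ler_wpM2l// le_lim.
  - by apply: cvgD; [exact: cvg_cst|apply: cvgM => //; exact: cvg_cst].
split => //.
have -> : (1 + x) * a ^+ 3 = (1 + 2 * x * a ^+ 2 + x * a) / (1 - x).
  by rewrite /a; field.
apply: (affine_recurrence_cvg _ _ (power_moment2S x)) => //.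
- exact: power_moment_homo.
- move=> k; rewrite lerD// ?lerD2l ler_wpM2l ?le_lim// mulr_ge0//.
- apply: cvgD; last by apply: cvgM => //; exact: cvg_cst.
  apply: cvgD; first exact: cvg_cst.
  by apply: cvgM => //; exact: cvg_cst.
Qed.

Lemma fine_esum_cvg (u : nat -> R) (l : R) : (forall j, 0 <= u j) ->
  (fun k => \sum_(j < k) u j) @ \oo --> l ->
  (fine (\esum_(j in [set: nat]) (u j)%:E) = l)%E.
Proof.
move=> u0 ul; rewrite -nneseries_esumT; last by move=> j; rewrite lee_fin.
have -> : (fun k => \sum_(0 <= j < k) (u j)%:E)%E = EFin \o (fun k => \sum_(j < k) u j).
  by apply/funext => k; rewrite /= -sumEFin big_mkord.
by rewrite EFin_lim; [rewrite (cvg_lim _ ul)|exact: cvgP ul].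
Qed.

Lemma sum_le_esum (I : choiceType) (s : seq I) (a : I -> \bar R) : uniq s ->
  (\sum_(i <- s) a i <= \esum_(i in [set: I]) a i)%E.
Proof.
move=> us; apply: esum_ge; exists [set` s]; last by rewrite -fsbig_seq.
by split => //; exact: finite_seq.
Qed.

End Moments.

Section VisitMoments.
Context {R : realType} {N : nat} (p : 'I_N -> bool -> bool -> R).
Hypothesis hp : channel_matrices p.
Implicit Types (n m : 'I_N) (M : nat).

(* First and second moments of the time up to the next NACK on a channel that
   was ON in the previous slot, and of the length L of a whole visit. *)
Definition burst1 n : R := (p n true false)^-1.
Definition burst2 n : R := (1 + p n true true) * burst1 n ^+ 2.
Definition visit1 n M : R := 1 + kstep p n M false true * burst1 n.
Definition visit2 n M : R :=
  1 + 2 * kstep p n M false true * burst1 n + kstep p n M false true * burst2 n.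

Lemma p11E n : p n true true = 1 - p n true false.
Proof. by have := channel_rowsum hp n true; lra. Qed.

Lemma p11_itv n : 0 <= p n true true < 1.
Proof.
by rewrite channel_ge0// p11E ltrBlDr ltrDl channel10_gt0.
Qed.

Lemma burst1_gt0 n : 0 < burst1 n.
Proof. by rewrite invr_gt0 channel10_gt0. Qed.

Lemma burst1E n : burst1 n = 1 + p n true true * burst1 n.
Proof. by rewrite p11E /burst1; field; rewrite gt_eqF// channel10_gt0. Qed.

Lemma burst2E n : burst2 n =
  1 + 2 * p n true true * burst1 n + p n true true * burst2 n.
Proof. by rewrite /burst2 p11E /burst1; field; rewrite gt_eqF// channel10_gt0. Qed.

Lemma L_pmf_ge0 n M j : 0 <= L_pmf p n M j.
Proof.
case: j => [|[|j]] //=; first by rewrite subr_ge0 kstep01_le1.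
by rewrite !mulr_ge0 ?exprn_ge0 ?kstep01_ge0 ?channel_ge0.
Qed.

Definition L_moment n M (e : nat) : R :=
  match e with 0 => 1 | 1 => visit1 n M | _ => visit2 n M end.

Lemma L_moment_cvg n M e : (e <= 2)%N ->
  (fun k => \sum_(j < k) j%:R ^+ e * L_pmf p n M j) @ \oo --> L_moment n M e.
Proof.
move=> e2; have [h0 h1 h2] := power_moment_cvg (p11_itv n).
(* The law of the visit length is geometric only from length 2 on; lengths 0 and 1 are split off. *)
rewrite -(cvg_shiftn 2) /=.
set q := p n true true in h0 h1 h2 *; set kap := kstep p n M false true.
pose c := kap * p n true false.
have a0 : (1 - q)^-1 = burst1 n by rewrite /q p11E subKr.
have pn0 : p n true false != 0 by rewrite gt_eqF// channel10_gt0.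
have split2 k : \sum_(j < k.+2) j%:R ^+ e * L_pmf p n M j =
    (1 - kap) + c * \sum_(i < k) i.+2%:R ^+ e * q ^+ i.
  rewrite !big_ord_recl/= mulr0 add0r /bump/= expr1n mul1r; congr (_ + _).
  rewrite mulr_sumr; apply: eq_bigr => i _.
  by rewrite !add1n /= /c -/q -/kap; ring.
(* The power of [i + 2] is expanded in powers of [i + 1]. *)
have binom k : \sum_(i < k) i.+2%:R ^+ e * q ^+ i =
    match e with
    | 0 => power_moment q 0 k
    | 1 => power_moment q 1 k + power_moment q 0 k
    | _ => power_moment q 2 k + 2 * power_moment q 1 k + power_moment q 0 k
    end.
  move: e e2 {split2} => [|[|[|//]]] _; rewrite /power_moment.
  - by apply: eq_bigr.
  - rewrite -big_split/=; apply: eq_bigr => i _.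
    by rewrite -[i.+2%:R]natr1; ring.
  - rewrite mulr_sumr -!big_split/=; apply: eq_bigr => i _.
    by rewrite -[i.+2%:R]natr1; ring.
pose lim2 k := (1 - kap) + c *
    match e with
    | 0 => power_moment q 0 k
    | 1 => power_moment q 1 k + power_moment q 0 k
    | _ => power_moment q 2 k + 2 * power_moment q 1 k + power_moment q 0 k
    end.
have limE : (fun k => \sum_(j < k + 2) j%:R ^+ e * L_pmf p n M j) = lim2.
  by apply/funext => k; rewrite addn2 split2 binom.
suff : lim2 @ \oo --> L_moment n M e by rewrite -limE.
rewrite /lim2.
rewrite (_ : L_moment n M e = (1 - kap) + c * match e with
    | 0 => (1 - q)^-1
    | 1 => (1 - q)^-1 ^+ 2 + (1 - q)^-1
    | _ => (1 + q) * (1 - q)^-1 ^+ 3 + 2 * (1 - q)^-1 ^+ 2 + (1 - q)^-1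
    end); last first.
  rewrite a0 /L_moment /visit1 /visit2 /burst2 /c -/kap -/q /burst1.
  by case: (e) => [|[|e']]; field.
apply: cvgD; first exact: cvg_cst.
apply: cvgM; first exact: cvg_cst.
case: (e) => [|[|e']] //; first exact: cvgD.
apply: cvgD => //; apply: cvgD => //.
by apply: cvgM => //; exact: cvg_cst.
Qed.

Lemma L_mean_id n M : L_mean p n M (fun j => j%:R) = visit1 n M.
Proof.
apply: fine_esum_cvg; first by move=> j; rewrite mulr_ge0 ?L_pmf_ge0.
exact: (@L_moment_cvg n M 1).
Qed.

Lemma L_mean_pred n M :
  L_mean p n M (fun j => j%:R - 1) = kstep p n M false true * burst1 n.
Proof.
apply: fine_esum_cvg.
  case=> [|j]; first by rewrite mulr0.
  by rewrite -natr1 addrK mulr_ge0 ?L_pmf_ge0.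
rewrite (_ : (fun k => _) = (fun k => \sum_(j < k) j%:R ^+ 1 * L_pmf p n M j -
                                 \sum_(j < k) j%:R ^+ 0 * L_pmf p n M j)).
  have -> : kstep p n M false true * burst1 n = visit1 n M - 1.
    by rewrite /visit1; ring.
  by apply: cvgB; [exact: (@L_moment_cvg n M 1)|exact: (@L_moment_cvg n M 0)].
by apply/funext => k; rewrite -sumrB; apply: eq_bigr => j _; ring.
Qed.

Lemma round_valueE (Q : 'rV[R]_N) (A : {set 'I_N}) : round_value p Q A =
  (\sum_(n in A) Q 0 n * (kstep p n #|A| false true * burst1 n)) /
  (\sum_(n in A) visit1 n #|A|).
Proof.
rewrite /round_value; congr (_ / _).
  by apply: eq_bigr => n _; rewrite L_mean_pred.
by apply: eq_bigr => n _; rewrite L_mean_id.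
Qed.

(* E[Tmax^2] as a squared mean plus a sum of variances *)
Definition Tmax2 : R := (\sum_n visit1 n N) ^+ 2 +
  \sum_n (visit2 n N - visit1 n N ^+ 2).

(** The sum over the box of lengths below [K] factors over the channels and tends to [Tmax2]; as a
    finite subsum it stays below the unordered sum. This direction suffices because the mean square
    is subtracted in the utility bound. *)
Lemma Tmax2_le : (Tmax2%:E <= Tmax_sq_mean p)%E.
Proof.
(* The exponent of [l k] in the product [l n * l m], one term of the expanded square. *)
pose w n m k := ((k == n) + (k == m))%N.
pose part K := \sum_n \sum_m \prod_k \sum_(j < K) j%:R ^+ w n m k * L_pmf p k N j.
have partcvg : part @ \oo --> Tmax2.
  have -> : Tmax2 = \sum_n \sum_m \prod_k L_moment k N (w n m k).
    rewrite /Tmax2 expr2 mulr_suml -big_split/=; apply: eq_bigr => n _.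
    have dist m : m != n -> \prod_k L_moment k N (w n m k) = visit1 n N * visit1 m N.
      move=> mn; rewrite (bigD1 n)//= (bigD1 m)//= big1 ?mulr1.
        by rewrite /w !eqxx (eq_sym n m) (negbTE mn).
      by move=> k /andP[kn km]; rewrite /w (negbTE kn) (negbTE km).
    have diag : \prod_k L_moment k N (w n n k) = visit2 n N.
      rewrite (bigD1 n)//= big1 ?mulr1; first by rewrite /w eqxx.
      by move=> k kn; rewrite /w (negbTE kn).
    rewrite [in LHS](bigD1 n)//= [in RHS](bigD1 n)//= diag (eq_bigr _ dist).
    by rewrite -mulr_sumr; ring.
  rewrite /part; apply: cvg_big; first exact: add_continuous.
  move=> n _; apply: cvg_big; first exact: add_continuous.
  move=> m _; apply: cvg_big; first exact: mul_continuous.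
  by move=> k _; apply: L_moment_cvg; rewrite /w; do 2!case: eqP.
have partle K : ((part K)%:E <= Tmax_sq_mean p)%E.
  pose h (l : {ffun 'I_N -> 'I_K}) : {ffun 'I_N -> nat} := [ffun n => l n : nat].
  have hinj : injective h.
    move=> l l' /ffunP E; apply/ffunP => n; apply: val_inj.
    by have := E n; rewrite !ffunE.
  have us : uniq (map h (index_enum {ffun 'I_N -> 'I_K})).
    by rewrite map_inj_uniq ?index_enum_uniq.
  apply: le_trans (sum_le_esum _ us).
  rewrite big_map sumEFin lee_fin le_eqVlt; apply/orP; left; apply/eqP.
  transitivity (\sum_(l : {ffun 'I_N -> 'I_K}) \sum_n \sum_m
     \prod_k ((l k)%:R ^+ w n m k * L_pmf p k N (l k))).
    rewrite /part [RHS]exchange_big/=; apply: eq_bigr => n _.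
    rewrite [RHS]exchange_big/=; apply: eq_bigr => m _.
    by rewrite (bigA_distr_bigA (fun k (j : 'I_K) => j%:R ^+ w n m k * L_pmf p k N j)).
  apply: eq_bigr => l _.
  have -> : \prod_n L_pmf p n N (h l n) = \prod_n L_pmf p n N (l n).
    by apply: eq_bigr => n _; rewrite ffunE.
  rewrite natr_sum expr2 mulr_suml mulr_suml; apply: eq_bigr => n _.
  rewrite mulr_sumr mulr_suml; apply: eq_bigr => m _.
  rewrite big_split/=; congr (_ * _); rewrite !ffunE /w.
  have pick i : \prod_k (l k)%:R ^+ (k == i) = (l i)%:R :> R.
    by rewrite (bigD1 i)//= eqxx expr1 big1 ?mulr1// => k /negbTE ->; rewrite expr0.
  by under eq_bigr do rewrite exprD; rewrite big_split/= !pick.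
case E : (Tmax_sq_mean p) partle => [r| |] partle; last 2 first.
- by rewrite leey.
- by have := partle 0%N.
- rewrite lee_fin -(cvg_lim _ partcvg)//; apply: limr_le; first exact: cvgP partcvg.
  by apply: nearW => K; rewrite -lee_fin.
Qed.

End VisitMoments.

(** * Drift of the Lyapunov functions *)

Section RemainingRound.
Context {R : realType} {N : nat} (p : 'I_N -> bool -> bool -> R).
Hypothesis hp : channel_matrices p.
Implicit Types (n m : 'I_N) (M : nat) (l : seq 'I_N) (cur : option 'I_N).

(* Moments of the remaining length of a round, and its expected remaining
   service weighted by [q], when packets are being sent over [cur] and the
   channels in [l] are still to be visited. *)
Definition left1 M cur l : R :=
  (if cur is Some n then burst1 p n else 0) + \sum_(n <- l) visit1 p n M.

(** The square of a sum of independent visit lengths is expanded one visit at a time. *)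
Fixpoint visits2 M l : R :=
  if l is n :: l' then
    visit2 p n M + 2 * visit1 p n M * left1 M None l' + visits2 M l'
  else 0.

Definition left2 M cur l : R :=
  if cur is Some n then
    burst2 p n + 2 * burst1 p n * left1 M None l + visits2 M l
  else visits2 M l.

(** A burst ends with a NACK slot that serves nothing, hence [burst1 p n - 1]. For a visit not yet
    begun the expected service is that of [L - 1]. *)
Definition left_gain (q : 'rV[R]_N) M cur l : R :=
  (if cur is Some n then q 0 n * (burst1 p n - 1) else 0) +
  \sum_(n <- l) q 0 n * (kstep p n M false true * burst1 p n).

Lemma left1_nil M : left1 M None [::] = 0.
Proof. by rewrite /left1 big_nil addr0. Qed.

Lemma left1_cons M n l : left1 M None (n :: l) = visit1 p n M + left1 M None l.
Proof. by rewrite /left1 big_cons !add0r. Qed.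

Lemma left1_Some M n l : left1 M (Some n) l = burst1 p n + left1 M None l.
Proof. by rewrite /left1 add0r. Qed.

Lemma left_gain_nil q M : left_gain q M None [::] = 0.
Proof. by rewrite /left_gain big_nil addr0. Qed.

Lemma left_gain_cons q M n l : left_gain q M None (n :: l) =
  q 0 n * (kstep p n M false true * burst1 p n) + left_gain q M None l.
Proof. by rewrite /left_gain big_cons !add0r. Qed.

Lemma left_gain_Some q M n l : left_gain q M (Some n) l =
  q 0 n * (burst1 p n - 1) + left_gain q M None l.
Proof. by rewrite /left_gain add0r. Qed.

Lemma visit1_ge1 n M : 1 <= visit1 p n M.
Proof. by rewrite /visit1 lerDl mulr_ge0 ?kstep01_ge0// ltW// burst1_gt0. Qed.

Lemma visit1_ge0 n M : 0 <= visit1 p n M.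
Proof. exact: le_trans (visit1_ge1 n M). Qed.

Lemma burst1_ge1 n : 1 <= burst1 p n.
Proof.
by rewrite (burst1E hp) lerDl mulr_ge0 ?channel_ge0// ltW// burst1_gt0.
Qed.

Lemma burst1_le2 n : burst1 p n <= burst2 p n.
Proof.
have b1 := ltW (burst1_gt0 hp n); have q0 := channel_ge0 hp n true true.
have b2 : 0 <= burst2 p n by rewrite /burst2 mulr_ge0 ?addr_ge0 ?exprn_ge0.
have := burst2E hp n; have := burst1E hp n.
by have := mulr_ge0 q0 b1; have := mulr_ge0 q0 b2; lra.
Qed.

Lemma burst2_ge0 n : 0 <= burst2 p n.
Proof. exact: le_trans (ltW (burst1_gt0 hp n)) (burst1_le2 n). Qed.

Lemma visit1_le2 n M : visit1 p n M <= visit2 p n M.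
Proof.
have k0 := kstep01_ge0 hp n M.
have := mulr_ge0 k0 (ltW (burst1_gt0 hp n)); have := mulr_ge0 k0 (burst2_ge0 n).
by rewrite /visit1 /visit2; lra.
Qed.

Lemma left1_ge0 M cur l : 0 <= left1 M cur l.
Proof.
rewrite addr_ge0//; first by case: cur => // n; exact/ltW/burst1_gt0.
by rewrite sumr_ge0// => n _; exact: visit1_ge0.
Qed.

Lemma left1_le_visits2 M l : left1 M None l <= visits2 M l.
Proof.
elim: l => [|n l IH]; first by rewrite left1_nil.
rewrite left1_cons /= lerD// -[leLHS]addr0 lerD ?visit1_le2//.
by rewrite mulr_ge0 ?left1_ge0// mulr_ge0// visit1_ge0.
Qed.

Lemma left1_le2 M cur l : left1 M cur l <= left2 M cur l.
Proof.
case: cur => [n|]; last exact: left1_le_visits2.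
rewrite left1_Some /left2 lerD ?left1_le_visits2// -[leLHS]addr0 lerD//.
  exact: burst1_le2.
by rewrite mulr_ge0 ?left1_ge0// mulr_ge0// ltW// burst1_gt0.
Qed.

Lemma visits2E M l : visits2 M l =
  (\sum_(n <- l) visit1 p n M) ^+ 2 +
  \sum_(n <- l) (visit2 p n M - visit1 p n M ^+ 2).
Proof.
elim: l => [|n l IH]; first by rewrite !big_nil/= expr0n addr0.
by rewrite /= IH /left1 !big_cons add0r; ring.
Qed.

Lemma visit1_mono n M M' : (M <= M')%N -> visit1 p n M <= visit1 p n M'.
Proof.
move=> MM; rewrite lerD2l ler_wpM2r ?kstep01_le//; exact/ltW/burst1_gt0.
Qed.

Lemma visit2_mono n M M' : (M <= M')%N -> visit2 p n M <= visit2 p n M'.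
Proof.
move=> MM; have k := kstep01_le hp n MM.
rewrite lerD ?ler_wpM2r ?burst2_ge0// lerD2l ler_wpM2r//.
  exact/ltW/burst1_gt0.
by rewrite ler_wpM2l.
Qed.

Lemma left1_mono M M' cur l : (M <= M')%N -> left1 M cur l <= left1 M' cur l.
Proof. by move=> MM; rewrite lerD2l ler_sum// => n _; exact: visit1_mono. Qed.

Lemma visits2_mono M M' l : (M <= M')%N -> visits2 M l <= visits2 M' l.
Proof.
move=> MM; elim: l => [//|n l IH] /=; apply: lerD IH; apply: lerD; first exact: visit2_mono.
apply: ler_pM.
- by rewrite mulr_ge0// visit1_ge0.
- exact: left1_ge0.
- by rewrite ler_wpM2l// visit1_mono.
- exact: left1_mono.
Qed.

Lemma visits2_cat M l l' : visits2 M l' <= visits2 M (l ++ l').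
Proof.
elim: l => [//|n l IH] /=; apply: (le_trans IH); rewrite lerDr addr_ge0//.
  exact: le_trans (visit1_ge0 n M) (visit1_le2 n M).
by rewrite mulr_ge0 ?left1_ge0// mulr_ge0// visit1_ge0.
Qed.

(** Raising the number of active channels to [N] increases every [P01^(M)], and adding the missing
    channels adds visits: both only lengthen the round. *)
Lemma visits2_le_Tmax2 M l : uniq l -> (M <= N)%N -> visits2 M l <= Tmax2 p.
Proof.
move=> ul MN; apply: (le_trans (visits2_mono l MN)).
pose l' := [seq n <- enum 'I_N | n \notin l].
apply: (le_trans (visits2_cat N l' l)); rewrite visits2E /Tmax2.
have pl : perm_eq (l' ++ l) (index_enum 'I_N).
  apply: uniq_perm; rewrite ?index_enum_uniq//.
    rewrite cat_uniq ul filter_uniq ?enum_uniq// andbT /=.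
    by apply/hasPn => n nl; rewrite /l' mem_filter negb_and negbK nl.
  move=> n; rewrite mem_cat mem_filter mem_enum mem_index_enum andbT.
  by case: (n \in l).
by rewrite !(perm_big _ pl).
Qed.

Lemma left1_le M cur l : uniq l ->
  left1 M cur l <= \sum_n (burst1 p n + (1 + burst1 p n)).
Proof.
move=> ul; rewrite big_split/=; have b0 n := ltW (burst1_gt0 hp n).
apply: lerD.
  case: cur => [n|]; last by rewrite sumr_ge0.
  by rewrite (bigD1 n)//= lerDl sumr_ge0.
rewrite (big_uniq _ ul)/= [leRHS](bigID (mem l))/=.
rewrite -[leLHS]addr0 lerD//; last by rewrite sumr_ge0// => n _; rewrite addr_ge0.
by apply: ler_sum => n _; rewrite lerD2l ler_piMl ?kstep01_le1.
Qed.

Lemma left_gain_le (q : 'rV[R]_N) M cur l : uniq l -> (forall n, 0 <= q 0 n) ->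
  left_gain q M cur l <= \sum_n q 0 n * (burst1 p n + burst1 p n).
Proof.
move=> ul q0; have b0 n := ltW (burst1_gt0 hp n).
under eq_bigr do rewrite mulrDr.
rewrite big_split/=; apply: lerD.
  case: cur => [n|]; last by rewrite sumr_ge0// => n _; rewrite mulr_ge0.
  rewrite (bigD1 n)//= -[leLHS]addr0 lerD//.
    by rewrite ler_wpM2l// lerBlDr lerDl.
  by rewrite sumr_ge0// => m _; rewrite mulr_ge0.
rewrite (big_uniq _ ul)/= [leRHS](bigID (mem l))/=.
rewrite -[leLHS]addr0 lerD//.
  by apply: ler_sum => n _; rewrite ler_wpM2l// ler_piMl ?kstep01_le1.
by rewrite sumr_ge0// => n _; rewrite mulr_ge0.
Qed.

Definition hit_prob M cur l : R :=
  match cur, l with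
  | Some n, _ => p n true true
  | None, n :: _ => kstep p n M false true
  | None, [::] => 0
  end.

Definition in_use cur l := if cur is Some n then Some n else ohead l.

Definition after_hit cur l (b : bool) : option 'I_N :=
  if b then in_use cur l else None.

Definition rest cur l := if cur is Some _ then l else behead l.

Definition idle cur l : bool := if cur is Some _ then false else nilp l.

(** One slot later the mean remaining time has dropped by one. The idle round, which has no channel
    left, counts as remaining time 1. *)
Lemma mix_left1 M cur l :
  mix (hit_prob M cur l) (left1 M (after_hit cur l true) (rest cur l))
    (left1 M (after_hit cur l false) (rest cur l)) =
  (if idle cur l then 1 else left1 M cur l) - 1.
Proof.
case: cur => [n|] /=.
  by rewrite !left1_Some /mix {2}(burst1E hp); ring.
case: l => [|n l]/=; first by rewrite left1_nil /mix; ring.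
by rewrite left1_Some left1_cons /mix /visit1; ring.
Qed.

(** With [T] the remaining time, this is the mean of the expanded square of [T - 1]. *)
Lemma mix_left2 M cur l :
  mix (hit_prob M cur l) (left2 M (after_hit cur l true) (rest cur l))
    (left2 M (after_hit cur l false) (rest cur l)) =
  (if idle cur l then 1 else left2 M cur l)
  - 2 * (if idle cur l then 1 else left1 M cur l) + 1.
Proof.
case: cur => [n|] /=.
  rewrite !left1_Some /mix; move: (left1 M None l) (visits2 M l) => S V.
  have := burst2E hp n; have := burst1E hp n.
  set b := burst1 p n; set b2 := burst2 p n; set q := p n true true => bE b2E.
  have qb : q * b = b - 1 by rewrite [in RHS]bE; ring.
  have qb2 : q * b2 = b2 - 1 - 2 * (b - 1) by rewrite {2}b2E -qb; ring.
  have qbS : q * (2 * b * S) = 2 * (b - 1) * S by rewrite -qb; ring.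
  by rewrite !mulrDr qb2 qbS; ring.
case: l => [|n l]/=; first by rewrite /mix; ring.
by rewrite left1_cons /mix /visit1 /visit2; ring.
Qed.

Lemma mix_left_gain (q : 'rV[R]_N) M cur l :
  mix (hit_prob M cur l) (left_gain q M (after_hit cur l true) (rest cur l))
    (left_gain q M (after_hit cur l false) (rest cur l)) =
  left_gain q M cur l -
  hit_prob M cur l * (if in_use cur l is Some n then q 0 n else 0).
Proof.
case: cur => [n|] /=.
  have := burst1E hp n; rewrite !left_gain_Some /mix.
  set b := burst1 p n; set r := p n true true => bE.
  have rb : r * b = b - 1 by rewrite [in RHS]bE; ring.
  transitivity (q 0 n * (r * b - r) + left_gain q M None l); first ring.
  by rewrite rb; ring.
case: l => [|n l]/=; first by rewrite left_gain_nil /mix; ring.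
by rewrite left_gain_Some left_gain_cons /mix; ring.
Qed.

End RemainingRound.

Section Drift.
Context {R : realType} {N : nat} (p : 'I_N -> bool -> bool -> R).
Context (g : 'rV[R]_N -> R) (Vg : R) (rho : rule R N).
Hypotheses (hp : channel_matrices p) (hrho : is_QRRNUM p g Vg rho).
Implicit Types (c : config R N) (h : seq (config R N * action N)) (m n : 'I_N) (y : network R N).

Local Notation K := (belief_op (packet_threshold p \o conf) (@network_belief R N)
  (@channel_in_use R N \o conf) (advance p rho)).

Definition hit y st v : bool := current (next_conf p y st v) != None.

Lemma next_current y st v : current (next_conf p y st v) =
  after_hit (current (conf y)) (todo (conf y)) (hit y st v).
Proof.
rewrite /hit /next_conf /after_hit /in_use /end_slot /chosen_action /=.
case: (current _) => [n|]; first by case: (st n).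
by case: (todo _) => [//|n l]; case: v => //=; case: (st n).
Qed.

Lemma next_todo y st v : todo (next_conf p y st v) =
  rest (current (conf y)) (todo (conf y)).
Proof. by []. Qed.

Lemma hitE y (b v : bool) : hit y (fun=> b) v =
  match current (conf y), todo (conf y) with
  | Some _, _ => b
  | None, _ :: _ => v && b
  | None, [::] => false
  end.
Proof.
rewrite /hit /next_conf /end_slot /chosen_action /=.
case: (current _) => [n|]; first by case: b.
by case: (todo _) => [//|n l]; case: v => //=; case: b.
Qed.

Definition hit_rate y :=
  hit_prob p (nactive (conf y)) (current (conf y)) (todo (conf y)).

(* A packet is sent on switching with probability kstep / belief and succeeds
   with probability belief, so that the belief cancels out. *)
Lemma belief_op_hit F y (B : bool -> R) : controlled p g Vg y ->
  (forall st v, F (advance p rho y st v) <= B (hit y st v)) ->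
  K F y <= mix (hit_rate y) (B true) (B false).
Proof.
move=> cy FB; have [sc oc] := (scheduled_conf cy, observed_conf cy).
have fb b v : F (advance p rho y (fun=> b) v) <= B _ := FB (fun=> b) v.
have hE := hitE y; move: fb; rewrite /belief_op /hit_rate /hit_prob /=.
have := current_belief sc; have := todo_belief sc.
rewrite /channel_in_use /packet_threshold /network_belief.
case Ec: (current (conf y)) hE => [n|] hE.
  move=> _ /(_ n erefl) -> fb; rewrite -[leRHS](mix_same (clip 0)).
  have p01 : 0 <= p n true true <= 1 by rewrite channel_ge0// channel11_le1.
  by apply: ler_mix (clip_itv 0) _ _; apply: ler_mix p01 _ _;
    rewrite (le_trans (fb _ _))// hE.
case Et: (todo (conf y)) hE => [|n l] hE tb _ fb /=.
  rewrite -[leRHS](mix_same (clip 0)).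
  by apply: ler_mix (clip_itv 0) _ _; rewrite (le_trans (fb _ _))// hE /mix mul0r subr0 mul1r add0r.
have b0 := observed_belief_gt0 hp n oc.
have b01 : 0 <= belief (conf y) 0 n <= 1 by rewrite (ltW b0) (belief_le1 oc).
have kb := tb [::] n l erefl; rewrite subn0 in kb.
set kap := kstep _ _ _ _ _ in kb *; set b := belief _ _ _ in b0 b01 kb *.
have q01 : 0 <= kap / b <= 1.
  by rewrite divr_ge0 ?kstep01_ge0 ?(ltW b0)// ler_pdivrMr// mul1r.
rewrite clip_id//.
apply: (@le_trans _ _ (mix (kap / b) (mix b (B true) (B false))
                          (mix b (B false) (B false)))).
  by do 2?[apply: ler_mix => //]; rewrite (le_trans (fb _ _))// hE.
rewrite mix_same le_eqVlt; apply/orP; left; apply/eqP.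
by rewrite /mix; field; rewrite gt_eqF.
Qed.

Definition time1 y : R := if round_over (conf y) then 1
  else left1 p (nactive (conf y)) (current (conf y)) (todo (conf y)).

Definition time2 y : R := if round_over (conf y) then 1
  else left2 p (nactive (conf y)) (current (conf y)) (todo (conf y)).

(* Expected sum of the 1 + age over the slots left in the round: a remaining
   time T contributes (1 + age) T + T (T - 1) / 2. *)
Definition age_cost y : R := (1 + (age y)%:R) * time1 y + (time2 y - time1 y) / 2.

(* The correction terms make the expected drift of the squared backlogs the
   same in every slot of a round, and they cancel at its beginning because
   [round_rate] is the ratio of expected service to expected length. *)
Definition energy y : R :=
  (\sum_n backlog (conf y) 0 n ^+ 2) / 2
  - left_gain p (round_backlog y) (nactive (conf y)) (current (conf y)) (todo (conf y))
  + round_rate y * time1 y.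

Lemma time1_ge1 y : 1 <= time1 y.
Proof.
rewrite /time1 /round_over; case: (current _) => [n|].
  rewrite left1_Some -[leLHS]addr0 lerD ?left1_ge0// burst1_ge1//.
case: (todo _) => [|n l] //=.
by rewrite left1_cons -[leLHS]addr0 lerD ?left1_ge0// visit1_ge1.
Qed.

Lemma time1_le2 y : time1 y <= time2 y.
Proof. by rewrite /time1 /time2; case: ifP => // _; rewrite left1_le2. Qed.

Lemma age_cost_ge y : 1 + (age y)%:R <= age_cost y.
Proof.
rewrite /age_cost -[leLHS]addr0 lerD//; last first.
  by rewrite divr_ge0// subr_ge0 time1_le2.
by rewrite ler_peMr ?time1_ge1// addr_ge0.
Qed.

Lemma new_round_active h c : let A := dec_active (rho h c) in
  [/\ A != finset.set0, perm_eq (dec_order (rho h c)) (enum A) &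
      (#|A| <= N)%N].
Proof.
have := hrho h c; case: (rho h c) => r A o /= [_ [A0 _] [pe _]]; split => //.
by rewrite -[leqRHS]card_ord max_card.
Qed.

Lemma new_round_conf h c : round_over c ->
  let y := new_round p rho h c in
  let A := dec_active (rho h c) in
  let run := 0 < round_value p (backlog c) A in
  [/\ current (conf y) = None, nactive (conf y) = if run then #|A| else 0%N &
      todo (conf y) = if run then dec_order (rho h c) else [::]].
Proof.
move=> ro /=; have := begin_slot_conf p rho h ro.
by case: (rho h c) => r A o /= ->.
Qed.

Lemma Tmax2_ge1 : 1 <= Tmax2 p.
Proof.
(* A valid rule always returns a nonempty active set, here on an arbitrary configuration, so at
   least one channel exists. *)
have [/set0Pn[n _] _ _] := new_round_active [::] (init_config (fun=> fun=> 0)).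
apply: le_trans (visits2_le_Tmax2 hp (M := 0) (l := [:: n]) _ _) => //.
by rewrite /= left1_nil mulr0 !addr0 (le_trans (visit1_ge1 hp n 0))// visit1_le2.
Qed.

(** At age 0 the cost is the average of the first two moments of the round length, hence at most the
    second. *)
Lemma age_cost_new_round h c : round_over c ->
  age_cost (new_round p rho h c) <= Tmax2 p.
Proof.
move=> ro; have [Ec En Et] := new_round_conf h ro.
rewrite /age_cost addr0 mul1r.
have t12 := time1_le2 (new_round p rho h c).
suff : time2 (new_round p rho h c) <= Tmax2 p by lra.
rewrite /time2; case: ifP => _; first exact: Tmax2_ge1.
rewrite Ec En Et /=; case: ifP => _.
  have [_ pe AN] := new_round_active h c.
  by apply: visits2_le_Tmax2 => //; rewrite (perm_uniq pe) enum_uniq.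
by rewrite /= (le_trans ler01)// Tmax2_ge1.
Qed.

Lemma energy_new_round h c : round_over c ->
  energy (new_round p rho h c) = (\sum_n backlog c 0 n ^+ 2) / 2.
Proof.
move=> ro; have [Ec En Et] := new_round_conf h ro.
have [Eb _ _ _] := begin_slot_same p rho h c.
rewrite /energy /= Eb -addrA -[RHS]addr0; congr (_ + _).
rewrite /time1 /round_over Ec En Et.
have [A0 pe _] := new_round_active h c.
case: ltP => run; last by rewrite left_gain_nil /= mul0r oppr0 addr0.
have o0 : nilp (dec_order (rho h c)) = false.
  apply/negbTE; rewrite /nilp (perm_size pe) -cardE; apply: contra A0.
  by move=> /eqP/cards0_eq ->.
rewrite o0 round_valueE//.
rewrite /left_gain /left1 !add0r !(perm_big _ pe) !big_enum/=.
set S := \sum_(n in _) visit1 _ _ _.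
rewrite divfK ?addNr// gt_eqF//.
have [n nA] := set0Pn _ A0.
rewrite /S (bigD1 n)//= ltr_wpDr ?(lt_le_trans ltr01 (visit1_ge1 hp _ _))//.
by rewrite sumr_ge0// => m _; exact: visit1_ge0.
Qed.

Lemma next_idle y st v : round_over (next_conf p y st v) ->
  after_hit (current (conf y)) (todo (conf y)) (hit y st v) = None /\
  rest (current (conf y)) (todo (conf y)) = [::].
Proof.
rewrite -next_current -(next_todo y st v) /round_over; case: (current _) => //.
by move=> /nilP.
Qed.

Definition next1 y b := left1 p (nactive (conf y))
  (after_hit (current (conf y)) (todo (conf y)) b) (rest (current (conf y)) (todo (conf y))).

Definition next2 y b := left2 p (nactive (conf y))
  (after_hit (current (conf y)) (todo (conf y)) b) (rest (current (conf y)) (todo (conf y))).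

Lemma mix_next1 y : mix (hit_rate y) (next1 y true) (next1 y false) = time1 y - 1.
Proof. exact: mix_left1. Qed.

Lemma mix_next2 y : mix (hit_rate y) (next2 y true) (next2 y false) =
  time2 y - 2 * time1 y + 1.
Proof. exact: mix_left2. Qed.

Definition next_cost y b :=
  (2 + (age y)%:R) * next1 y b + (next2 y b - next1 y b) / 2.

Lemma mix_next_cost y :
  mix (hit_rate y) (next_cost y true) (next_cost y false) =
  age_cost y - (1 + (age y)%:R).
Proof.
have -> : mix (hit_rate y) (next_cost y true) (next_cost y false) =
  (2 + (age y)%:R) * mix (hit_rate y) (next1 y true) (next1 y false) +
  (mix (hit_rate y) (next2 y true) (next2 y false) -
   mix (hit_rate y) (next1 y true) (next1 y false)) / 2.
  by rewrite /next_cost /mix; field.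
by rewrite mix_next1 mix_next2 /age_cost; field.
Qed.

Lemma advance_cont y st v : ~~ round_over (next_conf p y st v) ->
  [/\ time1 (advance p rho y st v) = next1 y (hit y st v),
      time2 (advance p rho y st v) = next2 y (hit y st v) &
      age (advance p rho y st v) = (age y).+1].
Proof.
move=> ro; have E : conf (advance p rho y st v) = next_conf p y st v.
  by rewrite /advance (negbTE ro).
by rewrite /time1 /time2 E (negbTE ro) next_current /advance (negbTE ro).
Qed.

(** Within a round the cost decreases in mean by the term of the current slot. The cost of a
    possible new round, at most [Tmax2], is charged in every slot. *)
Lemma belief_op_age_cost y : controlled p g Vg y ->
  K age_cost y <= age_cost y - (1 + (age y)%:R) + Tmax2 p.
Proof.
move=> cy.
have -> : age_cost y - (1 + (age y)%:R) + Tmax2 p =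
    mix (hit_rate y) (next_cost y true + Tmax2 p) (next_cost y false + Tmax2 p).
  by rewrite -mix_next_cost /mix; ring.
apply: (belief_op_hit cy (B := fun b => next_cost y b + Tmax2 p)) => st v.
have T1 := Tmax2_ge1.
have [ro|ro] := boolP (round_over (next_conf p y st v)).
  rewrite /advance ro; apply: le_trans (age_cost_new_round _ ro) _.
  have [E1 E2] := next_idle ro.
  by rewrite /next_cost /next1 /next2 E1 E2 left1_nil /= mulr0 subrr mul0r !add0r.
have [E1 E2 Ea] := advance_cont ro.
rewrite /age_cost E1 E2 Ea -natr1 /next_cost; move: (next1 _ _) (next2 _ _) => *; lra.
Qed.

(** With [Tmax2] times the remaining time subtracted, a new round starts at a nonpositive value,
    since a round lasts at least one slot. The summand [Tmax2] in the drift now comes from the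
    remaining time decreasing by one. *)
Lemma belief_op_age_cost_time y : controlled p g Vg y ->
  K (fun z => age_cost z - Tmax2 p * time1 z) y <=
  age_cost y - Tmax2 p * time1 y - (1 + (age y)%:R) + Tmax2 p.
Proof.
move=> cy.
have -> : age_cost y - Tmax2 p * time1 y - (1 + (age y)%:R) + Tmax2 p =
    mix (hit_rate y) (next_cost y true - Tmax2 p * next1 y true)
      (next_cost y false - Tmax2 p * next1 y false).
  transitivity (age_cost y - (1 + (age y)%:R) - Tmax2 p * (time1 y - 1)); first ring.
  by rewrite -mix_next_cost -mix_next1 /mix; ring.
apply: (belief_op_hit cy (B := fun b => next_cost y b - Tmax2 p * next1 y b)) => st v.
have T1 := Tmax2_ge1.
have [ro|ro] := boolP (round_over (next_conf p y st v)).
  rewrite /advance ro.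
  have [E1 E2] := next_idle ro.
  rewrite /next_cost /next1 /next2 E1 E2 left1_nil /= !mulr0 subrr mul0r !addr0 subr0.
  rewrite subr_le0; apply: le_trans (age_cost_new_round _ ro) _.
  by rewrite ler_peMr ?time1_ge1// (le_trans ler01).
have [E1 E2 Ea] := advance_cont ro.
rewrite /age_cost E1 E2 Ea -natr1 /next_cost; move: (next1 _ _) (next2 _ _) => *; lra.
Qed.

(** Expanding the square gives [Q * (r - s)] plus half of [s ^+ 2 + r ^+ 2], which is at most 1.
    Replacing [Q] by the backlog [q] seen at the start of the round costs at most [i], as [r - s]
    lies in [-1,1]. *)
Lemma backlog_square_step (Q q s r i : R) : 0 <= Q -> `|Q - q| <= i ->
  0 <= s <= 1 -> 0 <= r <= 1 ->
  (Num.max (Q - s) 0 + r) ^+ 2 / 2 <= Q ^+ 2 / 2 + q * (r - s) + (1 + i).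
Proof.
move=> Q0 Qq /andP[s0 s1] /andP[r0 r1].
have sq : (Num.max (Q - s) 0 + r) ^+ 2 <= (Q - s) ^+ 2 + r ^+ 2 + 2 * r * Q.
  by case: (leP 0 (Q - s)) => h; nra.
have diff : (Q - q) * (r - s) <= i.
  apply: le_trans (ler_norm _) _; rewrite normrM -[i]mulr1.
  by apply: ler_pM => //; rewrite ler_norml; lra.
nra.
Qed.

Lemma energy_drift y : controlled p g Vg y ->
  K energy y <= energy y
    + (\sum_n round_backlog y 0 n * admitted (conf y) 0 n - round_rate y)
    + N%:R * (1 + (age y)%:R).
Proof.
move=> cy.
pose M := nactive (conf y); pose cur := current (conf y); pose l := todo (conf y).
pose q := round_backlog y.
(* Bound on the energy after the slot, given whether a packet got through. In mean, the weighted
   service cancels against the drop of [left_gain], and the drop of the remaining time contributes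
   [- round_rate y]. *)
pose B b := (\sum_n backlog (conf y) 0 n ^+ 2) / 2
  + \sum_n q 0 n * admitted (conf y) 0 n + N%:R * (1 + (age y)%:R)
  - (if after_hit cur l b is Some n then q 0 n else 0)
  - left_gain p q M (after_hit cur l b) (rest cur l) + round_rate y * next1 y b.
have -> : energy y + (\sum_n round_backlog y 0 n * admitted (conf y) 0 n - round_rate y)
    + N%:R * (1 + (age y)%:R) = mix (hit_rate y) (B true) (B false).
  have G : mix (hit_rate y) (left_gain p q M (after_hit cur l true) (rest cur l))
        (left_gain p q M (after_hit cur l false) (rest cur l)) =
      left_gain p q M cur l -
      hit_rate y * (if in_use cur l is Some n then q 0 n else 0).
    exact: mix_left_gain.
  have -> : mix (hit_rate y) (B true) (B false) =
     (\sum_n backlog (conf y) 0 n ^+ 2) / 2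
    + \sum_n q 0 n * admitted (conf y) 0 n + N%:R * (1 + (age y)%:R)
    - hit_rate y * (if in_use cur l is Some n then q 0 n else 0)
    - mix (hit_rate y) (left_gain p q M (after_hit cur l true) (rest cur l))
        (left_gain p q M (after_hit cur l false) (rest cur l))
    + round_rate y * mix (hit_rate y) (next1 y true) (next1 y false).
    have affine (h a u x z r x' z' : R) : mix h (a - u - x + r * z) (a - 0 - x' + r * z') =
        a - h * u - mix h x x' + r * mix h z z' by rewrite /mix; ring.
    exact: affine.
  by rewrite G mix_next1 /energy -/q -/M -/cur -/l; ring.
apply: (belief_op_hit cy) => st v.
have Qstep : (\sum_n backlog (next_conf p y st v) 0 n ^+ 2) / 2 <=
  (\sum_n backlog (conf y) 0 n ^+ 2) / 2
  + \sum_n q 0 n * admitted (conf y) 0 n + N%:R * (1 + (age y)%:R)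
  - (if after_hit cur l (hit y st v) is Some n then q 0 n else 0).
  have -> : (if after_hit cur l (hit y st v) is Some n then q 0 n else 0) =
      \sum_n q 0 n * service R (chosen_action (conf y) v) st 0 n.
    have E n : service R (chosen_action (conf y) v) st 0 n =
        (after_hit cur l (hit y st v) == Some n)%:R.
      by rewrite (service_hit p _ _ _ (size (past y))) -/(next_conf p y st v) next_current.
    under eq_bigr do rewrite E.
    case: (after_hit _ _ _) => [n|]; last by rewrite big1// => n _; rewrite mulr0.
    rewrite (bigD1 n)//= eqxx mulr1 big1 ?addr0// => m mn.
    have -> : (Some n == Some m) = false by apply/eqP => -[nm]; rewrite nm eqxx in mn.
    by rewrite mulr0.
  have -> : N%:R * (1 + (age y)%:R) = \sum_(n < N) (1 + (age y)%:R) :> R.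
    by rewrite sumr_const card_ord mulr_natl.
  rewrite !mulr_suml -!big_split/= -sumrB; apply: ler_sum => n _.
  rewrite mxE; apply: le_trans (backlog_square_step _ (backlog_near cy n) _ _) _.
  - exact: backlog_ge0 cy n.
  - exact: service_itv.
  - exact: admitted_cube cy n.
  - by rewrite le_eqVlt; apply/orP; left; apply/eqP; rewrite /q; ring.
have [ro|ro] := boolP (round_over (next_conf p y st v)).
  rewrite /advance ro energy_new_round//; apply: (le_trans Qstep).
  have [E1 E2] := next_idle ro.
  by rewrite /B /next1 -/cur -/l in E1 E2 *; rewrite E1 E2 left1_nil left_gain_nil mulr0 addr0 !subr0.
have [E1 _ _] := advance_cont ro.
have Ec : conf (advance p rho y st v) = next_conf p y st v.
  by rewrite /advance (negbTE ro).
rewrite /energy E1 Ec next_current /B.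
have -> : round_rate (advance p rho y st v) = round_rate y.
  by rewrite /advance (negbTE ro).
have -> : round_backlog (advance p rho y st v) = q by rewrite /advance (negbTE ro).
by rewrite lerD2r lerD2r.
Qed.

End Drift.

(** * Utilities and the throughput region *)

Section UtilityFacts.
Context {R : realType} {N : nat}.

Lemma compact_cube : compact (@cube R N).
Proof.
have -> : @cube R N = [set v | forall n, `[0, 1]%classic (v ord0 n)].
  by apply/seteqP; split => v /= H n; have := H n; rewrite /= in_itv.
exact: (@rV_compact R N (fun=> `[0, 1]%classic) (fun=> @segment_compact R 0 1)).
Qed.

(** Uniform continuity on the compact cube, in the one-sided form used to compare throughput with
    admissions. *)
Lemma utility_unif_continuous (g : 'rV[R]_N -> R) (eps : R) : utility g ->
  0 < eps -> exists2 del, 0 < del & forall x y, cube x -> cube y ->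
    (forall n, `|x 0 n - y 0 n| < del) -> g x - eps <= g y.
Proof.
move=> [_ gc _ _] eps0.
have /compact_near_coveringP/near_covering_withinP cov := compact_cube.
have /subspace_continuousP gcont := gc.
have cov1 : \forall del \near 0^'+, cube `<=` (fun x : 'rV[R]_N => forall y, cube y ->
   (forall n, `|x 0 n - y 0 n| < del) -> g x - eps <= g y).
  apply: cov => x cx.
  have /cvgrPdist_lt/(_ (eps / 2) (divr_gt0 eps0 (ltr0Sn _ _))) := gcont x cx.
  rewrite near_withinE => /nbhs_ballP[d /= d0 dH].
  exists (ball x (d / 2), [set t | 0 < t < d / 2]) => /=.
    split; first by apply: nbhsx_ballx; rewrite divr_gt0.
    near=> t; apply/andP; split.
      by near: t; exact: nbhs_right_gt.
    by near: t; apply: nbhs_right_lt; rewrite divr_gt0.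
  move=> [x' t] /= [xx' /andP[t0 td]] cx' y cy x'y.
  have h1 : `|g x - g x'| < eps / 2.
    apply: dH => //; apply: le_ball xx'; rewrite ler_pdivrMr// ler_peMr ?ltW//.
    by rewrite ltr1n.
  have h2 : `|g x - g y| < eps / 2.
    apply: dH => //; rewrite [d]splitr; apply: ball_triangle xx' _.
    split; first by rewrite divr_gt0.
    by move=> i j; rewrite (ord1 i) /ball/=; apply: lt_trans td.
  by move: h1 h2; rewrite !ltr_norml => /andP[? ?] /andP[? ?]; lra.
have [del [del0 H]] := filter_ex (filterI (nbhs_right_gt 0) cov1).
by exists del => // x y cx cy; exact: H.
Unshelve. all: by end_near.
Qed.

Lemma utility_average (g : 'rV[R]_N -> R) (x : nat -> 'rV[R]_N) t : utility g ->
  (forall k, cube (x k)) -> (0 < t)%N ->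
  let xbar := \row_n (t%:R^-1 * \sum_(k < t) x k 0 n) in
  cube xbar /\ t%:R^-1 * \sum_(k < t) g (x k) <= g xbar.
Proof.
move=> ug cx; case: t => // t _; elim: t => [|t [cxb IH]] /=.
  have -> : \row_n (1%:R^-1 * \sum_(k < 1) x k 0 n) = x 0%N.
    by apply/matrixP => i j; rewrite ord1 mxE big_ord1 invr1 mul1r.
  by split; [exact: cx|rewrite big_ord1 invr1 mul1r].
(* The weight of the first [t.+1] terms in an average of [t.+2] terms. *)
pose q : R := t.+1%:R / t.+2%:R.
have t2 : t.+2%:R != 0 :> R by rewrite pnatr_eq0.
have t1 : t.+1%:R != 0 :> R by rewrite pnatr_eq0.
have q01 : 0 <= q <= 1 by rewrite divr_ge0//= ler_pdivrMr// mul1r ler_nat.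
have qC : 1 - q = t.+2%:R^-1.
  by apply: (mulIf t2); rewrite mulrBl /q divfK// mul1r mulVf// -[t.+2%:R]natr1 addrC addKr.
have step (f : nat -> R) : t.+2%:R^-1 * \sum_(k < t.+2) f k =
    mix q (t.+1%:R^-1 * \sum_(k < t.+1) f k) (f t.+1).
  by rewrite big_ord_recr/= mulrDr /mix qC; congr (_ + _); rewrite /q mulrA [_ / _ ]mulrC mulfK.
have -> : \row_n (t.+2%:R^-1 * \sum_(k < t.+2) x k 0 n) =
    \row_n mix q ((\row_n (t.+1%:R^-1 * \sum_(k < t.+1) x k 0 n)) 0 n) (x t.+1 0 n).
  by apply/matrixP => i j; rewrite !mxE (step (fun k => x k 0 j)).
split; first exact: cube_mix.
apply: le_trans (utility_mix ug q01 cxb (cx _)).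
by rewrite (step (fun k => g (x k))); apply: ler_mix.
Qed.

End UtilityFacts.

Section ThroughputRegion.
Context {R : realType} {N : nat} (p : 'I_N -> bool -> bool -> R).
Hypothesis hp : channel_matrices p.
Implicit Types (n m : 'I_N) (A : {set 'I_N}).

Lemma gainE n M : gain p n M = kstep p n M false true * burst1 p n.
Proof.
rewrite /gain /burst1 (kstep01E hp); have := channel01_gt0 hp n.
have := channel10_gt0 hp n => a0 b0; field.
by rewrite !gt_eqF ?addr_gt0.
Qed.

Lemma gain_ge0 n M : 0 <= gain p n M.
Proof. by rewrite gainE mulr_ge0 ?kstep01_ge0// ltW// burst1_gt0. Qed.

Lemma eta_denomE A : #|A|%:R + \sum_(m in A) gain p m #|A| =
  \sum_(n in A) visit1 p n #|A|.
Proof.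
rewrite /visit1 big_split/= sumr_const; congr (_ + _).
by apply: eq_bigr => n _; rewrite gainE.
Qed.

Lemma eta_itv A n : 0 <= eta p A 0 n <= 1.
Proof.
rewrite mxE; case: ifP => [nA|_]; last by rewrite lexx ler01.
have A0 : 0 < #|A|%:R + \sum_(m in A) gain p m #|A|.
  rewrite ltr_pwDl ?sumr_ge0// ?ltr0n; first by apply/card_gt0P; exists n.
  by move=> *; exact: gain_ge0.
rewrite divr_ge0 ?gain_ge0 ?(ltW A0)//= ler_pdivrMr// mul1r (bigD1 n)//=.
rewrite addrCA lerDl addr_ge0// sumr_ge0// => *; exact: gain_ge0.
Qed.

(** The ratio maximized by the algorithm is linear in the service vector [eta], so choosing the best
    active set is linear optimization over the vertices of the region. *)
Lemma round_value_eta (Q : 'rV[R]_N) A :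
  round_value p Q A = \sum_n Q 0 n * eta p A 0 n.
Proof.
rewrite (round_valueE hp) mulr_suml big_mkcond/=; apply: eq_bigr => n _.
rewrite mxE; case: ifP => _; last by rewrite mulr0.
by rewrite eta_denomE gainE -mulrA.
Qed.

(** A linear functional with nonnegative weights is bounded on the region by its values at the
    vertices [eta]. *)
Lemma Lambda_int_rate (Q y : 'rV[R]_N) (v : R) : (forall n, 0 <= Q 0 n) ->
  (forall A, A != finset.set0 -> round_value p Q A <= v) -> Lambda_int p y ->
  \sum_n Q 0 n * y 0 n <= v.
Proof.
move=> Q0 Qv [mu [w [w0 w1 ->]] ymu].
apply: (@le_trans _ _ (\sum_n Q 0 n *
   (\sum_(A : {set 'I_N} | A != finset.set0) w A *: eta p A) 0 n)).
  by apply: ler_sum => n _; rewrite ler_wpM2l//; case: (ymu n).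
rewrite -[leRHS]mul1r -w1 mulr_suml.
under eq_bigr do rewrite summxE mulr_sumr.
rewrite exchange_big/=; apply: ler_sum => A A0.
apply: le_trans (ler_wpM2l (w0 A) (Qv A A0)).
rewrite round_value_eta mulr_sumr; apply: ler_sum => n _.
by rewrite [X in _ * X]mxE mulrCA.
Qed.

Lemma Lambda_int_cube : Lambda_int p `<=` cube.
Proof.
move=> y [mu [w [w0 w1 ->]] ymu] n; have [-> yn] := ymu n; apply: (le_trans yn).
rewrite summxE -w1; apply: ler_sum => A _; rewrite mxE ler_piMr//.
by have /andP[] := eta_itv A n.
Qed.

Let weight (w : 'rV[R]_(#|{set 'I_N}|)) A : R := w 0 (enum_rank A).

(** Compactness of the region comes from this parametrization by mixture weights and by factors in
    [0,1] that shrink each coordinate. *)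
Let scaled (x : 'rV[R]_(#|{set 'I_N}|) * 'rV[R]_N) : 'rV[R]_N :=
  \row_n (x.2 0 n * \sum_(A : {set 'I_N} | A != finset.set0)
                       weight x.1 A * eta p A 0 n).

Let simplex : set 'rV[R]_(#|{set 'I_N}|) := [set w | cube w /\
  \sum_(A : {set 'I_N} | A != finset.set0) weight w A = 1].

Let weight_cont A : continuous (weight^~ A).
Proof. by move=> w; exact: coord_continuous. Qed.

Let scaled_continuous : continuous scaled.
Proof.
move=> x; apply/cvg_ballP => e e0.
have coord n : (fun z => scaled z 0 n) @ x --> scaled x 0 n.
  pose f (z : 'rV[R]_(#|{set 'I_N}|) * 'rV[R]_N) := z.2 0 n *
    \sum_(A : {set 'I_N} | A != finset.set0) weight z.1 A * eta p A 0 n.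
  have fE z : scaled z 0 n = f z by rewrite mxE.
  have -> : (fun z => scaled z 0 n) = f by apply/funext.
  rewrite fE; apply: cvgM.
    apply: (@continuous_comp _ _ _ snd (fun v : 'rV[R]_N => v 0 n)).
      exact: cvg_snd.
    exact: coord_continuous.
  apply: cvg_big; first exact: add_continuous.
  move=> A _; apply: cvgM; last exact: cvg_cst.
  apply: (@continuous_comp _ _ _ fst (weight^~ A)); first exact: cvg_fst.
  exact: weight_cont.
suff : \forall z \near x, forall n, ball (scaled x 0 n) e (scaled z 0 n).
  by apply: filterS => z H; split => // i j; rewrite (ord1 i).
have H n : \forall z \near x, ball (scaled x 0 n) e (scaled z 0 n).
  by have /cvg_ballP/(_ e e0) := coord n.
exact: (@filter_forall _ _ (fun n z => ball (scaled x 0 n) e (scaled z 0 n)) (nbhs x) _ H).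
Qed.

Let simplex_compact : compact simplex.
Proof.
pose S (w : 'rV[R]_(#|{set 'I_N}|)) :=
  \sum_(A : {set 'I_N} | A != finset.set0) weight w A.
have -> : simplex = cube `&` S @^-1` [set 1] by apply/seteqP; split.
apply: compact_closedI; first exact: compact_cube.
apply: preimage_closed; last exact: closed_eq.
move=> w _; apply: cvg_big; first exact: add_continuous.
  exact: (@nbhs_filter _ w).
by move=> A _; exact: weight_cont.
Qed.

Lemma Lambda_int_image : Lambda_int p = scaled @` (simplex `*` cube).
Proof.
apply/seteqP; split => y.
  move=> [mu [w [w0 w1 muE]] ymu].
  (* At the empty set [w] is only known to be nonnegative; it is reset to 0 so that [W] lies in the
     cube. *)
  pose W : 'rV[R]_(#|{set 'I_N}|) :=
    \row_k (if enum_val k == finset.set0 then 0 else w (enum_val k)).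
  have WE A : A != finset.set0 -> weight W A = w A.
    by move=> A0; rewrite /weight mxE enum_rankK (negbTE A0).
  have W1 : \sum_(A : {set 'I_N} | A != finset.set0) weight W A = 1.
    by rewrite -[RHS]w1; apply: eq_bigr => A /WE.
  (* Where [mu] vanishes so does [y], and division by zero yields the admissible factor 0. *)
  exists (W, \row_n (y 0 n / mu 0 n)).
    split; [split => // k|move=> n] => /=; rewrite mxE.
      case: ifPn => k0; first by rewrite lexx ler01.
      by rewrite w0/= -w1 (bigD1 (enum_val k))//= lerDl sumr_ge0.
    have [y0 yn] := ymu n; have mu0 := le_trans y0 yn.
    rewrite divr_ge0//=; have [->|m0] := eqVneq (mu 0 n) 0.
      by rewrite invr0 mulr0 ler01.
    by rewrite ler_pdivrMr ?mul1r// lt0r m0.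
  apply/matrixP => i n; rewrite !mxE /= ord1.
  have -> : \sum_(A : {set 'I_N} | A != finset.set0) weight W A * eta p A 0 n = mu 0 n.
    by rewrite muE summxE; apply: eq_bigr => A A0; rewrite WE// [in RHS]mxE.
  have [y0 yn] := ymu n; have [m0|m0] := eqVneq (mu 0 n) 0.
    by rewrite m0 mulr0; apply/eqP; rewrite eq_le y0 -m0 yn.
  by rewrite divfK.
move=> [[W th] [[/= cW W1] cth] <-].
exists (\sum_(A : {set 'I_N} | A != finset.set0) weight W A *: eta p A).
  exists (weight W); split => // A; by have /andP[] := cW (enum_rank A).
move=> n; rewrite summxE mxE /=.
have -> : \sum_(A : {set 'I_N} | A != finset.set0) (weight W A *: eta p A) 0 n =
    \sum_(A : {set 'I_N} | A != finset.set0) weight W A * eta p A 0 n.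
  by apply: eq_bigr => A _; rewrite mxE.
have /andP[th0 th1] := cth n.
have s0 : 0 <= \sum_(A : {set 'I_N} | A != finset.set0) weight W A * eta p A 0 n.
  apply: sumr_ge0 => A _; apply: mulr_ge0; first by have /andP[] := cW (enum_rank A).
  by have /andP[] := eta_itv A n.
by split; [exact: mulr_ge0|exact: ler_piMl].
Qed.

Lemma Lambda_int_compact : compact (Lambda_int p).
Proof.
rewrite Lambda_int_image; apply: continuous_compact.
  exact: continuous_subspaceT scaled_continuous.
by apply: compact_setX; [exact: simplex_compact|exact: compact_cube].
Qed.

Lemma Lambda_int_max (g : 'rV[R]_N -> R) : (0 < N)%N -> utility g ->
  exists2 y, Lambda_int p y & forall z, Lambda_int p z -> g z <= g y.
Proof.
move=> N0 [_ gc _ _].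
have [||y yL ymax] := compact_EVT_max (f := g) _ Lambda_int_compact.
- exists 0; exists (eta p (finset.setTfor 'I_N)).
    exists (fun A => (A == (finset.setTfor 'I_N))%:R).
    have T0 : (finset.setTfor 'I_N) != finset.set0.
      by apply/set0Pn; exists (Ordinal N0); rewrite inE.
    split => //; rewrite (bigD1 (finset.setTfor 'I_N))//= eqxx.
      by rewrite big1 ?addr0// => A /andP[_ /negbTE ->].
    rewrite scale1r big1 ?addr0// => A /andP[_ /negbTE ->].
    by rewrite scale0r.
  by move=> n; rewrite mxE lexx; case/andP: (eta_itv (finset.setTfor 'I_N) n).
- exact: continuous_subspaceW Lambda_int_cube gc.
by exists y; [rewrite inE in yL|move=> z zL; apply: ymax; rewrite inE].
Qed.

End ThroughputRegion.

(** * Long-run averages *)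

Lemma telescope_le {R : realType} (u v : nat -> R) t :
  (forall k, u k.+1 <= u k + v k) -> u t <= u 0%N + \sum_(k < t) v k.
Proof.
move=> uv; elim: t => [|t IH]; first by rewrite big_ord0 addr0.
by rewrite big_ord_recr/= addrA; apply: le_trans (uv t) _; rewrite lerD2r.
Qed.

Section RoundBounds.
Context {R : realType} {N : nat} (p : 'I_N -> bool -> bool -> R).
Context (g : 'rV[R]_N -> R) (Vg : R).
Hypothesis hp : channel_matrices p.

(** The bound is uniform in [M] because [P01^(M)] is at most 1. Constants of this kind only enter
    the terms that stay bounded in [t]. *)
Lemma left2_bounded : exists D : R, forall M cur l, uniq l -> left2 p M cur l <= D.
Proof.
have b10 n : 0 <= burst1 p n by exact/ltW/burst1_gt0.
pose b1 := \sum_n burst1 p n; pose b2 := \sum_n burst2 p n.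
pose D1 := \sum_n (burst1 p n + (1 + burst1 p n)).
pose D2 := D1 ^+ 2 + \sum_n (1 + 2 * burst1 p n + burst2 p n).
have D10 : 0 <= D1 by rewrite sumr_ge0// => n _; rewrite !addr_ge0.
have visits M l : uniq l -> visits2 p M l <= D2.
  move=> ul; rewrite visits2E// lerD//.
    have := left1_le hp M None ul; have := left1_ge0 hp M None l.
    by rewrite /left1 add0r => ? ?; rewrite lerXn2r ?nnegrE.
  rewrite (big_uniq _ ul)/= [leRHS](bigID (mem l))/= -[leLHS]addr0 lerD//.
    apply: ler_sum => n _; apply: (@le_trans _ _ (visit2 p n M)).
      by rewrite lerBlDr lerDl sqr_ge0.
    rewrite /visit2 lerD ?ler_piMl ?kstep01_le1 ?burst2_ge0// lerD2l.
    by rewrite -mulrA ler_wpM2l// ler_piMl ?kstep01_le1.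
  by rewrite sumr_ge0// => n _; have := b10 n; have := burst2_ge0 hp n; lra.
exists (b2 + 2 * b1 * D1 + D2) => M cur l ul.
have S1 := left1_le hp M None ul.
have b1n n : burst1 p n <= b1 by rewrite /b1 (bigD1 n)//= lerDl sumr_ge0.
have b2n n : burst2 p n <= b2.
  by rewrite /b2 (bigD1 n)//= lerDl sumr_ge0// => m _; rewrite burst2_ge0.
have b20 : 0 <= b2 by rewrite sumr_ge0// => n _; exact: burst2_ge0.
have b1s : 0 <= b1 by rewrite sumr_ge0.
case: cur => [n|] /=; last first.
  by rewrite -[leLHS]add0r lerD ?visits// addr_ge0// !mulr_ge0.
rewrite lerD ?visits// lerD//; apply: ler_pM => //.
- by rewrite mulr_ge0.
- exact: left1_ge0.
- by rewrite ler_wpM2l.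
Qed.

Lemma round_bounds : exists2 D : R, 1 <= D & forall y, controlled p g Vg y ->
  [/\ time1 p y <= D, age_cost p y <= D * (1 + (age y)%:R) &
      left_gain p (round_backlog y) (nactive (conf y)) (current (conf y))
        (todo (conf y)) <= D * \sum_n round_backlog y 0 n].
Proof.
have [D2' D2h] := left2_bounded; pose D2 := Num.max 1 D2'.
pose D1 := 1 + \sum_n (burst1 p n + (1 + burst1 p n)).
pose D3 := \sum_n (burst1 p n + burst1 p n).
have b10 n : 0 <= burst1 p n by exact/ltW/burst1_gt0.
have D21 : 1 <= D2 by rewrite le_max lexx.
have D11 : 1 <= D1 by rewrite lerDl sumr_ge0// => n _; rewrite !addr_ge0.
have D30 : 0 <= D3 by rewrite sumr_ge0// => n _; rewrite addr_ge0.
exists (D1 + D2 + D3) => [|y cy]; first by lra.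
have ul := todo_uniq (scheduled_conf cy).
have t1 : time1 p y <= D1.
  rewrite /time1; case: ifP => // _.
  by apply: (le_trans (left1_le hp _ _ ul)); rewrite lerDr.
have t2 : time2 p y <= D2.
  by rewrite /time2; case: ifP => // _; rewrite le_max D2h ?orbT.
have t11 := time1_ge1 hp y.
have age0 : 0 <= (age y)%:R :> R by [].
split; first lra.
  have h1 : (1 + (age y)%:R) * time1 p y <= (1 + (age y)%:R) * D1.
    by rewrite ler_wpM2l// addr_ge0.
  have h2 : D2 <= D2 * (1 + (age y)%:R) by rewrite ler_peMr ?lerDl//; lra.
  have h3 : 0 <= D3 * (1 + (age y)%:R) by rewrite mulr_ge0// addr_ge0.
  by rewrite /age_cost; lra.
have q0 := round_backlog_ge0 cy.
apply: le_trans (left_gain_le hp _ _ ul q0) _.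
rewrite mulr_sumr; apply: ler_sum => n _; rewrite mulrC ler_wpM2r//.
apply: (@le_trans _ _ D3); last by lra.
by rewrite /D3 (bigD1 n)//= lerDl sumr_ge0// => m _; rewrite addr_ge0.
Qed.

End RoundBounds.

Section LongRun.
Context {R : realType} {N : nat} (p : 'I_N -> bool -> bool -> R).
Context (pi : 'I_N -> bool -> R) (g : 'rV[R]_N -> R) (Vg : R) (rho : rule R N).
Hypotheses (hp : channel_matrices p) (hpi : stationary p pi).
Hypotheses (hrho : is_QRRNUM p g Vg rho) (ug : utility g) (Vg0 : 0 < Vg).
Implicit Types (n m : 'I_N) (y z : network R N).

Local Notation K := (belief_op (packet_threshold p \o conf) (@network_belief R N)
  (@channel_in_use R N \o conf) (advance p rho)).

Definition network_mean (t : nat) (F : network R N -> R) : R :=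
  kernel_mean (packet_threshold p \o conf) (@network_belief R N)
    (@channel_in_use R N \o conf) (advance p rho) t F (start p pi rho).

Local Notation E := network_mean.

Let I_step y st v : controlled p g Vg y -> controlled p g Vg (advance p rho y st v).
Proof. exact: controlled_advance. Qed.

Let I_bel y n : controlled p g Vg y -> 0 <= network_belief y n <= 1.
Proof. by move=> /(controlled_belief hp); apply. Qed.

Let I_start : controlled p g Vg (start p pi rho).
Proof. exact: controlled_start. Qed.

Lemma network_mean_le t F G : (forall z, controlled p g Vg z -> F z <= G z) ->
  E t F <= E t G.
Proof. exact: (kernel_mean_le _ _ I_step I_bel). Qed.

Lemma network_mean0 F : E 0 F = F (start p pi rho).
Proof. by []. Qed.

Lemma network_meanD t F G : E t (fun z => F z + G z) = E t F + E t G.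
Proof. exact: kernel_meanD. Qed.

Lemma network_meanZ t c F : E t (fun z => c * F z) = c * E t F.
Proof. exact: kernel_meanZ. Qed.

Lemma network_mean_cst t c : E t (fun=> c) = c.
Proof. exact: kernel_mean_cst. Qed.

Lemma network_mean_affine t a b c F G :
  E t (fun z => a * F z + b + c * G z) = a * E t F + b + c * E t G.
Proof.
rewrite (network_meanD t (fun z => a * F z + b)) network_meanZ.
by rewrite (network_meanD t (fun z => a * F z)) network_meanZ network_mean_cst.
Qed.

Lemma network_mean_drift t F G :
  (forall z, controlled p g Vg z -> K F z <= F z + G z) ->
  E t.+1 F <= E t F + E t G.
Proof. by apply: kernel_mean_drift. Qed.

Lemma network_mean_ge0 t F : (forall z, controlled p g Vg z -> 0 <= F z) -> 0 <= E t F.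
Proof. by move=> F0; rewrite -(network_mean_cst t 0); exact: network_mean_le. Qed.

Definition slots_aged y : R := 1 + (age y)%:R.

(** As [age_cost] is at most [D] times [slots_aged], the drift contracts its mean by the factor
    [1 - D^-1] up to an additive [Tmax2]. The bound is the initial value plus the fixed point
    [D * Tmax2]. *)
Lemma slots_aged_bounded : exists C, forall t, E t slots_aged <= C.
Proof.
have [D D1 Db] := round_bounds g Vg hp.
have D0 : 0 < D by exact: lt_le_trans D1.
pose B := age_cost p (start p pi rho) + D * Tmax2 p.
have T0 : 0 <= Tmax2 p by apply: le_trans (Tmax2_ge1 hp hrho).
have H t : E t (age_cost p) <= B.
  elim: t => [|t IH]; first by rewrite /B lerDl mulr_ge0// ltW.
  have h1 : E t.+1 (age_cost p) <= E t (age_cost p) + E t (fun z => Tmax2 p + (-1) * slots_aged z).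
    apply: network_mean_drift => z cz.
    by apply: le_trans (belief_op_age_cost hp hrho cz) _; rewrite /slots_aged; lra.
  have h2 : E t (age_cost p) <= D * E t slots_aged.
    by rewrite -network_meanZ; apply: network_mean_le => z /Db[].
  rewrite network_meanD network_meanZ network_mean_cst in h1.
  have c0 : 0 <= age_cost p (start p pi rho).
    by apply: le_trans (age_cost_ge hp _); rewrite addr_ge0.
  have h3 : E t (age_cost p) - E t slots_aged + Tmax2 p <= B.
    have h4 : D^-1 * E t (age_cost p) <= E t slots_aged.
      by rewrite ler_pdivrMl.
    have h5 : D^-1 <= 1 by rewrite invf_le1.
    have h6 : (1 - D^-1) * E t (age_cost p) <= (1 - D^-1) * B.
      by rewrite ler_wpM2l// subr_ge0.
    have h7 : D^-1 * B = D^-1 * age_cost p (start p pi rho) + Tmax2 p.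
      by rewrite /B mulrDr mulrA mulVf ?mul1r// gt_eqF.
    have h8 : 0 <= D^-1 * age_cost p (start p pi rho) by rewrite mulr_ge0// invr_ge0 ltW.
    nra.
  lra.
exists B => t; apply: le_trans (H t); apply: network_mean_le => z _.
exact: age_cost_ge.
Qed.

(** The drift of [W] telescopes, and [W] is bounded below because the remaining time is at most
    [D]. *)
Lemma slots_aged_sum : exists C, forall t,
  \sum_(k < t) E k slots_aged <= Tmax2 p * t%:R + C.
Proof.
have [D D1 Db] := round_bounds g Vg hp.
have T0 : 0 <= Tmax2 p by apply: le_trans (Tmax2_ge1 hp hrho).
pose W z := age_cost p z - Tmax2 p * time1 p z.
exists (W (start p pi rho) + Tmax2 p * D) => t.
have step k : E k.+1 W <= E k W + (Tmax2 p - E k slots_aged).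
  have -> : Tmax2 p - E k slots_aged = E k (fun z => Tmax2 p + (-1) * slots_aged z).
    by rewrite network_meanD network_meanZ network_mean_cst mulN1r.
  apply: network_mean_drift => z cz.
  apply: le_trans (belief_op_age_cost_time hp hrho cz) _.
  by rewrite /slots_aged /W; lra.
have := telescope_le t step; rewrite sumrB sumr_const card_ord -[_ *+ t]mulr_natr.
have : - (Tmax2 p * D) <= E t W.
  rewrite -(network_mean_cst t (- _)); apply: network_mean_le => z cz.
  have [z1 _ _] := Db z cz; have := age_cost_ge hp z.
  have : 0 <= (age z)%:R :> R by [].
  have := ler_wpM2l T0 z1; rewrite /W; lra.
rewrite network_mean0; lra.
Qed.

Definition backlog_squares y : R := \sum_n backlog (conf y) 0 n ^+ 2.

(** The negative of the part of the energy drift governed by the decisions; a lower bound on it, by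
    a utility gap or by a backlog, turns the telescoped energy into a performance bound. *)
Definition round_deficit y : R :=
  round_rate y - \sum_n round_backlog y 0 n * admitted (conf y) 0 n.

Lemma deficit_sum : exists C, forall t,
  \sum_(k < t) E k round_deficit + E t backlog_squares / 4 <=
  N%:R * Tmax2 p * t%:R + C.
Proof.
have [D D1 Db] := round_bounds g Vg hp.
have [C1 hC1] := slots_aged_bounded; have [C2 hC2] := slots_aged_sum.
have D0 : 0 <= D by exact: le_trans D1.
exists (energy p (start p pi rho) + N%:R * C2 + N%:R * (D ^+ 2 + D * C1)) => t.
have step k : E k.+1 (energy p) <=
    E k (energy p) + (N%:R * E k slots_aged - E k round_deficit).
  have -> : N%:R * E k slots_aged - E k round_deficit =
      E k (fun z => N%:R * slots_aged z + 0 + (-1) * round_deficit z).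
    by rewrite network_mean_affine addr0 mulN1r.
  apply: network_mean_drift => z cz.
  apply: le_trans (energy_drift hp hrho cz) _.
  by rewrite /slots_aged /round_deficit; lra.
have := telescope_le t step; rewrite sumrB -mulr_sumr.
have low : E t backlog_squares / 4 - N%:R * (D ^+ 2 + D * C1) <= E t (energy p).
  have h : E t backlog_squares / 4 - N%:R * (D ^+ 2 + D * E t slots_aged) <= E t (energy p).
    have -> : E t backlog_squares / 4 - N%:R * (D ^+ 2 + D * E t slots_aged) =
      E t (fun z => 4^-1 * backlog_squares z + - (N%:R * D ^+ 2) +
                    (- (N%:R * D)) * slots_aged z).
      by rewrite network_mean_affine; ring.
    apply: network_mean_le => z cz; have [_ _ Dg] := Db z cz.
    have rt : 0 <= round_rate z * time1 p z.
      rewrite mulr_ge0 ?(round_rate_ge0 cz)// (le_trans _ (time1_ge1 hp z))//.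
    (* The energy holds half of the squared backlogs. The term [left_gain], linear in the backlogs,
       is absorbed by a quarter of them through a completed square, which leaves the quarter of the
       statement. *)
    have sq : D * \sum_n round_backlog z 0 n <= backlog_squares z / 4 +
        N%:R * D ^+ 2 + N%:R * D * (age z)%:R.
      rewrite -addrA.
      have -> : N%:R * D ^+ 2 + N%:R * D * (age z)%:R =
          \sum_(n < N) (D ^+ 2 + D * (age z)%:R) :> R.
        by rewrite sumr_const card_ord -mulr_natl; ring.
      rewrite mulr_sumr mulr_suml -big_split/=; apply: ler_sum => n _.
      have := backlog_near cz n; rewrite ler_norml => /andP[nr _].
      have h1 : D * round_backlog z 0 n <= D * (backlog (conf z) 0 n + (age z)%:R).
        by rewrite ler_wpM2l//; lra.
      have := sqr_ge0 (backlog (conf z) 0 n / 2 - D); nra.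
    have ND : 0 <= N%:R * D by rewrite mulr_ge0.
    by move: sq Dg; rewrite /energy /slots_aged /backlog_squares; lra.
  apply: le_trans h; rewrite lerD2l lerN2 ler_wpM2l// lerD2l ler_wpM2l//.
have := ler_wpM2l (ler0n R N) (hC2 t).
rewrite network_mean0; lra.
Qed.

Let cube1 : cube (const_mx 1 : 'rV[R]_N).
Proof. by move=> n; rewrite mxE lexx ler01. Qed.

Let cube0 : cube (0 : 'rV[R]_N).
Proof. by move=> n; rewrite mxE lexx ler01. Qed.

Lemma utility_le1 r : cube r -> g r <= g (const_mx 1).
Proof.
by case: ug => _ _ _ mono cr; apply: mono => // n; rewrite mxE; case/andP: (cr n).
Qed.

Lemma utility_ge0 r : cube r -> 0 <= g r.
Proof. by case: ug => _ _ + _; apply. Qed.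

Lemma deficit_ge_utility y r : controlled p g Vg y -> Lambda_int p r ->
  Vg * (g r - g (admitted (conf y))) <= round_deficit y.
Proof.
move=> cy Lr; have := admitted_opt cy (Lambda_int_cube hp Lr).
have := Lambda_int_rate hp (round_backlog_ge0 cy) (round_rate_max cy) Lr.
by rewrite /admission_value /round_deficit; lra.
Qed.

(** The comparison is with admitting nothing, whose utility is nonnegative. *)
Lemma deficit_ge_rate y : controlled p g Vg y ->
  round_rate y - Vg * g (const_mx 1) <= round_deficit y.
Proof.
move=> cy; have := admitted_opt cy cube0.
rewrite /admission_value /round_deficit.
under [X in _ - X <= _ -> _]eq_bigr do rewrite mxE mulr0.
rewrite big1//; have := utility_ge0 cube0; have := utility_le1 (admitted_cube cy).
by move=> h1 h2; have := ler_wpM2l (ltW Vg0) h1; have := mulr_ge0 (ltW Vg0) h2; lra.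
Qed.

Lemma admitted_utility_sum ybar : Lambda_int p ybar -> exists C, forall t,
  t%:R * (g ybar - N%:R * Tmax2 p / Vg) - C <=
  \sum_(k < t) E k (fun y => g (admitted (conf y))).
Proof.
move=> Ly; have [C hC] := deficit_sum; exists (C / Vg) => t.
have h1 : \sum_(k < t) (Vg * g ybar - Vg * E k (fun y => g (admitted (conf y)))) <=
    \sum_(k < t) E k round_deficit.
  apply: ler_sum => k _.
  rewrite -network_meanZ -(network_mean_cst k (Vg * g ybar)) -mulN1r -network_meanZ -network_meanD.
  by apply: network_mean_le => z cz; have := deficit_ge_utility cz Ly; lra.
have sq0 : 0 <= E t backlog_squares.
  by apply: network_mean_ge0 => z _; rewrite sumr_ge0// => n _; exact: sqr_ge0.
have {}hC := hC t; rewrite sumrB sumr_const card_ord -mulr_sumr -[_ *+ t]mulr_natr in h1.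
rewrite -(ler_pM2l Vg0).
have -> : Vg * (t%:R * (g ybar - N%:R * Tmax2 p / Vg) - C / Vg) =
  Vg * g ybar * t%:R - N%:R * Tmax2 p * t%:R - C by field; rewrite gt_eqF.
lra.
Qed.

(** A second moment of order [t] makes the mean backlog sublinear, so that admissions and service
    have the same long-run averages. *)
Lemma backlog_squares_linear : exists C, forall t,
  E t backlog_squares <= C * (t%:R + 1).
Proof.
have [C hC] := deficit_sum.
pose G := Vg * g (const_mx 1).
have G0 : 0 <= G by rewrite mulr_ge0 ?utility_ge0// ltW.
have T0 : 0 <= N%:R * Tmax2 p by rewrite mulr_ge0// (le_trans _ (Tmax2_ge1 hp hrho)).
exists (4 * (N%:R * Tmax2 p + G + `|C|)) => t.
have h1 : \sum_(k < t) - G <= \sum_(k < t) E k round_deficit.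
  apply: ler_sum => k _; rewrite -(network_mean_cst k (- G)).
  apply: network_mean_le => z cz; have := deficit_ge_rate cz.
  by have := round_rate_ge0 cz; rewrite -/G; lra.
rewrite sumr_const card_ord -mulr_natr in h1.
have := hC t; have := ler_norm C; have t0 : 0 <= t%:R :> R by [].
have := mulr_ge0 (normr_ge0 C) t0; nra.
Qed.

(** Serving all channels gives user [n] the positive rate [e], so the optimal ratio dominates [e]
    times the backlog at the start of the round; passing to the current backlog costs [e] times the
    age. *)
Lemma backlog_sum_linear n : exists C, forall t,
  \sum_(k < t) E k (fun y => backlog (conf y) 0 n) <= C * (t%:R + 1).
Proof.
have [C hC] := deficit_sum; have [C2 hC2] := slots_aged_sum.
pose G := Vg * g (const_mx 1).
have G0 : 0 <= G by rewrite mulr_ge0 ?utility_ge0// ltW.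
have T0 : 0 <= Tmax2 p by rewrite (le_trans _ (Tmax2_ge1 hp hrho)).
pose T := finset.setTfor 'I_N.
have nT : n \in T by rewrite inE.
pose e := eta p T 0 n.
have e0 : 0 < e.
  rewrite /e mxE nT; apply: divr_gt0.
    rewrite gainE// mulr_gt0 ?burst1_gt0// kstep01_gt0//.
    by apply/card_gt0P; exists n.
  rewrite eta_denomE// (bigD1 n)//= ltr_pwDl ?(lt_le_trans _ (visit1_ge1 hp _ _))//.
  by rewrite sumr_ge0// => m _; exact: visit1_ge0.
have rate y : controlled p g Vg y -> e * round_backlog y 0 n <= round_rate y.
  move=> cy; have TN : T != finset.set0 by apply/set0Pn; exists n.
  apply: le_trans (round_rate_max cy TN); rewrite round_value_eta// (bigD1 n)//= mulrC.
  rewrite lerDl sumr_ge0// => m _; rewrite mulr_ge0 ?(round_backlog_ge0 cy)//.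
  by have /andP[] := eta_itv hp T m.
have h1 t : \sum_(k < t) (e * E k (fun y => backlog (conf y) 0 n) - G - e * E k slots_aged) <=
    \sum_(k < t) E k round_deficit.
  apply: ler_sum => k _.
  have -> : e * E k (fun y => backlog (conf y) 0 n) - G - e * E k slots_aged =
    E k (fun y => e * backlog (conf y) 0 n + - G + (- e) * slots_aged y).
    by rewrite (network_mean_affine k e _ _ (fun y => backlog (conf y) 0 n)); ring.
  apply: network_mean_le => z cz; have := deficit_ge_rate cz; have := rate z cz.
  have := backlog_near cz n; rewrite ler_norml /slots_aged -/G => /andP[_ nr].
  have : e * (backlog (conf z) 0 n - round_backlog z 0 n) <= e * (age z)%:R.
    by rewrite ler_wpM2l// ltW.
  lra.
clearbody G; exists (e^-1 * (N%:R * Tmax2 p + G + e * Tmax2 p + `|C| + e * `|C2|)) => t.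
rewrite -mulrA [leRHS]mulrC ler_pdivlMr// [leLHS]mulrC.
have sq0 : 0 <= E t backlog_squares.
  by apply: network_mean_ge0 => z _; rewrite sumr_ge0// => m _; exact: sqr_ge0.
have := h1 t; rewrite !sumrB -!mulr_sumr sumr_const card_ord -[_ *+ t]mulr_natr.
have := hC t; have := ler_wpM2l (ltW e0) (hC2 t).
have := ler_norm C; have := ler_wpM2l (ltW e0) (ler_norm C2).
have t0 : 0 <= t%:R :> R by [].
have := mulr_ge0 (normr_ge0 C) t0.
have := mulr_ge0 (mulr_ge0 (ltW e0) (normr_ge0 C2)) t0.
have := mulr_ge0 (ltW e0) T0; have := mulr_ge0 (ler0n R N) T0.
lra.
Qed.

End LongRun.

(** * Limits and network performance *)

Section Limits.
Context {R : realType}.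
Local Open Scope ereal_scope.

Lemma limn_einf_ge (u : (\bar R)^nat) (l : \bar R) T :
  (forall t, (T <= t)%N -> l <= u t) -> l <= limn_einf u.
Proof.
move=> lu; rewrite limn_einf_lim; apply: lime_ge; first exact: is_cvg_einfs.
exists T => // n /= Tn; apply/ereal_infP => _ [k /= nk <-].
by apply: lu; exact: leq_trans nk.
Qed.

Lemma limn_esup_le (u : (\bar R)^nat) (l : \bar R) :
  (forall t, u t <= l) -> limn_esup u <= l.
Proof.
move=> lu; rewrite limn_esup_lim; apply: lime_le; first exact: is_cvg_esups.
by apply: nearW => n; apply/ereal_supP => _ [k /= _ <-].
Qed.

End Limits.

Section Performance.
Context {R : realType} {N : nat} (p : 'I_N -> bool -> bool -> R).
Context (pi : 'I_N -> bool -> R) (g : 'rV[R]_N -> R) (Vg : R) (rho : rule R N).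
Context {d : measure_display} {Omega : measurableType d} (Pr : probability Omega R).
Context (s : 'I_N -> nat -> {RV Pr >-> bool}) (U : nat -> {RV Pr >-> R}).
Hypotheses (hp : channel_matrices p) (hpi : stationary p pi).
Hypotheses (hrho : is_QRRNUM p g Vg rho) (ug : utility g) (Vg0 : 0 < Vg).
Hypothesis sU : channel_processes p pi s U.
Implicit Types (n : 'I_N) (y : network R N).

Local Notation E := (network_mean p pi rho).
Local Notation Y := (chain_at s U (packet_threshold p \o conf) (advance p rho)
  (start p pi rho)).

Lemma served_before_ge0 y st v n : controlled p g Vg y ->
  0 <= served_before n (advance p rho y st v).
Proof.
by move=> cy; rewrite /served_before advance_past /= le_min (backlog_ge0 cy) ler0n.
Qed.

Lemma expectation_network (F : network R N -> R) t :
  (forall y, controlled p g Vg y -> (forall n, 0 <= served_before n y) -> 0 <= F y) ->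
  (\int[Pr]_w (F (Y t w))%:E = (E t F)%:E)%E.
Proof.
move=> F0; rewrite /network_mean.
apply: (@expectation_chain_inv R N p pi d Omega Pr s U _ _ _ _ _ _
  (fun y => controlled p g Vg y /\ forall n, 0 <= served_before n y)) => //.
- by move=> n i; have [_ + _ _ _] := hp n.
- by move=> n; have [] := hpi n.
- by move=> y st st' v H; exact: advance_dep.
- by move=> y st v n; exact: advance_belief.
- move=> n; rewrite /network_belief /start /=.
  have [_ -> _ _] := begin_slot_same p rho [::] (init_config pi).
  by rewrite mxE.
- move=> y st v [cy _]; split; first exact: controlled_advance.
  by move=> n; exact: served_before_ge0.
- by move=> y n [cy _]; exact: (controlled_belief hp n cy).
- by split => //; exact: controlled_start.
- by move=> y [cy sy]; exact: F0.
Qed.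

Lemma expectation_backlog t n :
  ('E_Pr[backlog_at p pi s U rho t n] = (E t (fun y => backlog (conf y) 0 n))%:E)%E.
Proof.
rewrite unlock -expectation_network; last by move=> y cy _; exact: (backlog_ge0 cy).
apply: eq_integral => w _; rewrite /backlog_at /queue.
by have [-> _] := chain_network p pi rho (fun tau m => s m tau w) (fun tau => U tau w) t.
Qed.

Lemma expectation_served t n :
  ('E_Pr[served_at p pi s U rho t n] = (E t.+1 (served_before n))%:E)%E.
Proof.
rewrite unlock -expectation_network; last by move=> y _; apply.
by apply: eq_integral => w _; rewrite /served_at served_chain.
Qed.

(** Since [max(q - m, 0) = q - min(q, m)], the balance holds for every outcome of the slot, hence in
    mean. *)
Lemma served_balance t n :
  E t.+1 (served_before n) =
  E t (fun y => admitted (conf y) 0 n) + E t (fun y => backlog (conf y) 0 n)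
  - E t.+1 (fun y => backlog (conf y) 0 n).
Proof.
apply/eqP; rewrite eq_sym subr_eq; apply/eqP.
rewrite -network_meanD -[RHS](network_meanD p pi rho t.+1 (served_before n)).
rewrite /network_mean kernel_meanS; congr (kernel_mean _ _ _ _ _ _ _).
apply/funext => y; apply/esym; apply: belief_op_cst => st v.
rewrite /served_before advance_past advance_conf /=.
have [-> _ _ ->] := begin_slot_same p rho (next_past y v) (next_conf p y st v).
rewrite -(service_hit p _ _ _ (size (past y))).
have -> : backlog (next_conf p y st v) 0 n = Num.max (backlog (conf y) 0 n -
    service R (chosen_action (conf y) v) st 0 n) 0 + admitted (conf y) 0 n.
  by rewrite mxE.
move: (backlog _ _ _) (service _ _ _ _ _) (admitted _ _ _) => q m r.
have [qm|mq] := leP q m; first by rewrite max_r ?subr_le0//; ring.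
by rewrite max_l ?subr_ge0 ?ltW//; ring.
Qed.

Definition mean_admitted t : 'rV[R]_N := \row_n E t (fun y => admitted (conf y) 0 n).

(** The balance telescopes from empty queues: throughput is the average admission minus the backlog
    still waiting, divided by [t]. *)
Lemma throughputE t n : throughput p pi s U rho t 0 n =
  t%:R^-1 * \sum_(k < t) mean_admitted k 0 n -
  t%:R^-1 * E t (fun y => backlog (conf y) 0 n).
Proof.
rewrite mxE /time_average; under eq_bigr do rewrite expectation_served.
rewrite sumEFin -EFinM /= -mulrBr; congr (_ * _).
elim: t => [|t IH].
  rewrite !big_ord0 network_mean0 /start /=.
  have [-> _ _ _] := begin_slot_same p rho [::] (init_config pi).
  by rewrite mxE subrr.
by rewrite !big_ord_recr /= IH served_balance [mean_admitted t 0 n]mxE; ring.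
Qed.

Lemma mean_admitted_utility t : cube (mean_admitted t) /\
  E t (fun y => g (admitted (conf y))) <= g (mean_admitted t).
Proof.
have adv y st v : controlled p g Vg y -> controlled p g Vg (advance p rho y st v).
  exact: controlled_advance.
have bel y n : controlled p g Vg y -> 0 <= network_belief y n <= 1.
  by move=> cy; exact: (controlled_belief hp n cy).
apply: (kernel_mean_concave _ _ adv bel) => //; first exact: controlled_start.
by move=> z cz; exact: admitted_cube cz.
Qed.

(** The utility is controlled only on the cube. The lower bound is read off the service, the upper
    bound off the admissions, which dominate it. *)
Lemma throughput_cube t : cube (throughput p pi s U rho t).
Proof.
move=> n; apply/andP; split.
  rewrite mxE /time_average; under eq_bigr do rewrite expectation_served.
  rewrite sumEFin -EFinM /= mulr_ge0 ?invr_ge0// sumr_ge0// => k _.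
  rewrite /network_mean kernel_meanS.
  apply: (network_mean_ge0 hp hpi hrho) => z cz.
  apply: (@le_trans _ _ (belief_op (packet_threshold p \o conf)
    (@network_belief R N) (@channel_in_use R N \o conf) (advance p rho) (fun=> 0) z)).
    by rewrite (@belief_op_cst _ _ _ _ _ _ _ _ _ 0).
  apply: (@belief_op_le _ _ _ _ _ _ _ (controlled p g Vg)) => //.
    by move=> y m cy; exact: (controlled_belief hp m cy).
  by move=> st v; exact: served_before_ge0.
rewrite throughputE; apply: (@le_trans _ _ (t%:R^-1 * \sum_(k < t) mean_admitted k 0 n)).
  rewrite gerBl mulr_ge0 ?invr_ge0//.
  by apply: (network_mean_ge0 hp hpi hrho) => z cz; exact: backlog_ge0 cz n.
have [->|t0] := eqVneq t 0%N; first by rewrite big_ord0 mulr0.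
rewrite ler_pdivrMl ?ltr0n ?lt0n// mulr1.
apply: (@le_trans _ _ (\sum_(k < t) 1)); last by rewrite sumr_const card_ord.
by apply: ler_sum => k _; have [/(_ n)/andP[]] := mean_admitted_utility k.
Qed.

Lemma mean_backlog_sublinear n (eps : R) : 0 < eps ->
  exists T, forall t, (T <= t)%N -> E t (fun y => backlog (conf y) 0 n) <= eps * t%:R.
Proof.
move=> eps0; have [C0 hC0] := backlog_squares_linear hp hpi hrho ug Vg0.
pose C := `|C0| + 1; have C1 : 0 < C by rewrite ltr_pwDr.
(* The inequality [q <= del * q ^+ 2 + (4 * del)^-1] is used with [del] so small that the quadratic
   term costs at most half of [eps * t]; the constant [D] is below the other half for large [t]. *)
pose del := eps / (4 * C); have del0 : 0 < del by rewrite divr_gt0// mulr_gt0.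
pose D := (4 * del)^-1; have D0 : 0 < D by rewrite invr_gt0 mulr_gt0.
exists (Num.truncn (2 * D / eps)).+2 => t Tt.
have h1 : E t (fun y => backlog (conf y) 0 n) <= del * E t (@backlog_squares R N) + D.
  have := network_mean_affine p pi rho t del D 0 (@backlog_squares R N) (fun=> 0).
  rewrite (mul0r (E t (fun=> 0))) addr0 => <-; apply: (network_mean_le hp hpi hrho) => z cz.
  rewrite mul0r addr0.
  have q2 : backlog (conf z) 0 n ^+ 2 <= backlog_squares z.
    by rewrite /backlog_squares (bigD1 n)//= lerDl sumr_ge0// => m _; exact: sqr_ge0.
  apply: (@le_trans _ _ (del * backlog (conf z) 0 n ^+ 2 + D)); last first.
    by rewrite lerD2r ler_wpM2l// ltW.
  have sq := sqr_ge0 (2 * del * backlog (conf z) 0 n - 1).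
  have dD : 4 * del * D = 1 by rewrite /D mulfV// gt_eqF// mulr_gt0.
  rewrite -(ler_pM2l (mulr_gt0 (ltr0Sn R 3) del0)).
  move: sq dD; move: (backlog _ _ _) => q; rewrite mulrDr => sq ->; nra.
have t1 : 1 <= t%:R :> R by rewrite ler1n; apply: leq_trans Tt.
have h2 : del * E t (@backlog_squares R N) <= eps * t%:R / 2.
  have h3 : E t (@backlog_squares R N) <= C * (2 * t%:R).
    apply: (le_trans (hC0 t)); apply: (@le_trans _ _ (C * (t%:R + 1))).
      by rewrite ler_wpM2r ?addr_ge0// (le_trans (ler_norm C0))// lerDl.
    by apply: ler_wpM2l; [exact: ltW|lra].
  apply: (le_trans (ler_wpM2l (ltW del0) h3)).
  by rewrite le_eqVlt; apply/orP; left; apply/eqP; rewrite /del; field; rewrite gt_eqF.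
have h4 : D <= eps * t%:R / 2.
  have : 2 * D / eps <= t%:R.
    apply/ltW/(lt_le_trans (truncnS_gt _)); rewrite ler_nat.
    exact: leq_trans Tt.
  by rewrite ler_pdivrMr//; lra.
lra.
Qed.

Lemma QRRNUM_stabilizes : stabilizes p pi s U rho.
Proof.
move=> n; have [C hC] := backlog_sum_linear hp hpi hrho ug Vg0 n.
apply: (@le_lt_trans _ _ (2 * `|C|)%:E); last exact: ltry.
apply: limn_esup_le => t; rewrite /time_average.
under eq_bigr do rewrite expectation_backlog.
rewrite sumEFin -EFinM lee_fin.
have [->|t0] := eqVneq t 0%N; first by rewrite invr0 mul0r mulr_ge0.
rewrite ler_pdivrMl ?ltr0n ?lt0n//; apply: (le_trans (hC t)).
have t1 : 1 <= t%:R :> R by rewrite ler1n lt0n.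
have := ler_norm C; have := normr_ge0 C; nra.
Qed.

(** Jensen's inequality is used twice, over the randomness in each slot and over the slots. *)
Lemma QRRNUM_utility ybar : Lambda_int p ybar ->
  ((g ybar - N%:R * Tmax2 p / Vg)%:E <= achieved_utility p pi s U rho g)%E.
Proof.
move=> Ly; apply/lee_addgt0Pr => eps eps0.
have [del del0 gdel] := utility_unif_continuous ug (divr_gt0 eps0 (ltr0Sn R 1)).
have [C hC] := admitted_utility_sum hp hpi hrho Vg0 Ly.
have [T1 hT1] : exists T, forall t, (T <= t)%N -> forall n,
    E t (fun y => backlog (conf y) 0 n) <= del / 2 * t%:R.
  have [T hT] := fin_all_exists (fun n => mean_backlog_sublinear n (divr_gt0 del0 (ltr0Sn R 1))).
  exists (\max_n T n)%N => t Tt n; apply: hT; apply: leq_trans Tt.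
  exact: leq_bigmax.
pose T2 := (Num.truncn (2 * `|C| / eps)).+1.
rewrite -leeBlDr//; apply: (@limn_einf_ge _ _ _ (maxn T1 T2)) => t.
rewrite geq_max => /andP[T1t T2t]; rewrite -EFinB lee_fin.
have t0 : (0 < t)%N by apply: leq_trans T2t.
have tR : 0 < t%:R :> R by rewrite ltr0n.
have [cx gx] := utility_average ug (fun k => (mean_admitted_utility k).1) t0.
set x := \row_n _ in cx gx.
(* The throughput differs from the average admission [x] by the mean backlog over [t], which is
   below [del]; uniform continuity costs half of [eps], and the term [C / t] the other half. *)
apply: (@le_trans _ _ (g x - eps / 2)); last first.
  apply: gdel => //; first exact: throughput_cube.
  move=> n; rewrite throughputE mxE opprB addrC subrK.
  rewrite ger0_norm ?mulr_ge0 ?invr_ge0//; last first.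
    by apply: (network_mean_ge0 hp hpi hrho) => z cz; exact: backlog_ge0 cz n.
  rewrite ltr_pdivrMl// mulrC; apply: (le_lt_trans (hT1 t T1t n)).
  by rewrite ltr_pM2r// ltr_pdivrMr// ltr_pMr// ltr1n.
have h1 : g ybar - N%:R * Tmax2 p / Vg - C / t%:R <= g x.
  apply: le_trans gx; rewrite ler_pdivlMl//.
  apply: (@le_trans _ _ (\sum_(k < t) E k (fun y => g (admitted (conf y))))).
    apply: le_trans (hC t); rewrite mulrBr le_eqVlt; apply/orP; left; apply/eqP.
    by congr (_ - _); rewrite mulrC divfK// gt_eqF.
  by apply: ler_sum => k _; exact: (mean_admitted_utility k).2.
have h2 : C / t%:R <= eps / 2.
  rewrite ler_pdivrMr//.
  have : 2 * `|C| / eps <= t%:R.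
    by apply/ltW/(lt_le_trans (truncnS_gt _)); rewrite ler_nat.
  by rewrite ler_pdivrMr//; have := ler_norm C; lra.
lra.
Qed.

End Performance.

Theorem theorem2 (R : realType) (N : nat)
    (p : 'I_N -> bool -> bool -> R) (pi : 'I_N -> bool -> R)
    (g : 'rV[R]_N -> R)
    (d : measure_display) (Omega : measurableType d) (Pr : probability Omega R)
    (s : 'I_N -> nat -> {RV Pr >-> bool}) (U : nat -> {RV Pr >-> R}) :
  (0 < N)%N ->
  channel_matrices p ->
  stationary p pi ->
  utility g ->
  channel_processes p pi s U ->
  exists ybar : 'rV[R]_N,
    [/\ Lambda_int p ybar /\ (forall y, Lambda_int p y -> g y <= g ybar),
        forall Vg : R, 0 < Vg ->
        forall rho : rule R N, is_QRRNUM p g Vg rho ->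
          stabilizes p pi s U rho /\
          ((g ybar)%:E - drift_bound p * (Vg^-1)%:E
             <= achieved_utility p pi s U rho g)%E &
        forall eps : R, 0 < eps ->
        exists2 V0 : R, 0 < V0 &
          forall Vg : R, V0 <= Vg ->
          forall rho : rule R N, is_QRRNUM p g Vg rho ->
            ((g ybar - eps)%:E <= achieved_utility p pi s U rho g)%E].
Proof.
move=> N0 hp hpi ug sU.
have [ybar Ly ymax] := Lambda_int_max hp N0 ug.
exists ybar; split => //.
- move=> Vg Vg0 rho hrho; split; first exact: QRRNUM_stabilizes hrho _ _ _.
  apply: le_trans (QRRNUM_utility hp hpi hrho ug Vg0 sU Ly).
  rewrite EFinB leeB// EFinM lee_wpmul2r ?lee_fin ?invr_ge0 ?(ltW Vg0)//.
  rewrite /drift_bound EFinM lee_wpmul2l ?lee_fin//.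
  exact: Tmax2_le.
(* The threshold makes [N * Tmax2 / Vg] at most [eps]; the leading 1 keeps it positive. The closed
   form [Tmax2] is a real number, so finiteness of the extended mean square is not at issue. *)
- move=> eps eps0; exists (1 + N%:R * `|Tmax2 p| / eps).
    by rewrite ltr_pwDl// divr_ge0 ?mulr_ge0// ltW.
  move=> Vg VgV rho hrho.
  have Vg0 : 0 < Vg.
    by apply: lt_le_trans VgV; rewrite ltr_pwDl// divr_ge0 ?mulr_ge0// ltW.
  apply: le_trans (QRRNUM_utility hp hpi hrho ug Vg0 sU Ly).
  rewrite lee_fin lerD2l lerN2 ler_pdivrMr//.
  apply: (@le_trans _ _ (N%:R * `|Tmax2 p|)); first by rewrite ler_wpM2l// ler_norm.
  by rewrite [leRHS]mulrC -ler_pdivrMr//; apply: le_trans VgV; rewrite lerDr.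
Qed.
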